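(* The square root of free generator presentation $\langle\gamma_i\mid i\in\mathbb N\rangle$ of $\mathbb B_\infty$ gives rise to the system of Haar unitaries $\{L_{\gamma_i}\mid i\in\mathbb N\}$ such that $$L(\mathbb F_{r,t}^{1/2})=\bigvee\{L_{\gamma_s}\mid r\le s\le t\}$$ and such that one has the following triangular tower of commuting squares: $$\begin{matrix} \mathbb C&\subset&L(\mathbb F_{1,1}^{1/2})&\subset&L(\mathbb F_{1,2}^{1/2})&\subset&L(\mathbb F_{1,3}^{1/2})&\subset\cdots\subset&L(\mathbb F_{1,\infty}^{1/2})\\ &&\cup&&\cup&&\cup&&\cup\\ &&\mathbb C&\subset&L(\mathbb F_{2,2}^{1/2})&\subset&L(\mathbb F_{2,3}^{1/2})&\subset\cdots\subset&L(\mathbb F_{2,\infty}^{1/2})\\ &&&&\cup&&\cup&&\cup\\ &&&&\mathbb C&\subset&L(\mathbb F_{3,3}^{1/2})&\subset\cdots\subset&L(\mathbb F_{3,\infty}^{1/2})\\ &&&&&&\cup&&\cup\\ &&&&&&\vdots&&\vdots \end{matrix}$$ The squared family $\{L_{\gamma_i}^2\mid i\in\mathbb N\}$ is a free system of Haar unitaries in the sense of Voiculescu whose generated triangular tower is a restriction of the triangular tower formed by the algebras $L(\mathbb F_{r,t}^{1/2})$ (each $L(\mathbb F_{r,t}^{1/2})$ being replaced by its subalgebra $L(\mathbb F_{r,t})$): $$\begin{matrix} \mathbb C&\subset&L(\mathbb F_{1,1})&\subset&L(\mathbb F_{1,2})&\subset&L(\mathbb F_{1,3})&\subset\cdots\subset&L(\mathbb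 F_{1,\infty})\\ &&\cup&&\cup&&\cup&&\cup\\ &&\mathbb C&\subset&L(\mathbb F_{2,2})&\subset&L(\mathbb F_{2,3})&\subset\cdots\subset&L(\mathbb F_{2,\infty})\\ &&&&\cup&&\cup&&\cup\\ &&&&\mathbb C&\subset&L(\mathbb F_{3,3})&\subset\cdots\subset&L(\mathbb F_{3,\infty})\\ &&&&&&\cup&&\cup\\ &&&&&&\vdots&&\vdots \end{matrix}$$ Moreover, each cell in this (second) tower forms a commuting square $$\begin{matrix}C&\subset&D\\ \cup&&\cup\\ A&\subset&B\end{matrix}$$ such that $B$ and $C$ are freely independent with amalgamation over $A$.
   Context: $\mathbb B_\infty$ is the infinite braid group, generated by $\sigma_1,\sigma_2,\dots$ subject to $\sigma_i\sigma_j\sigma_i=\sigma_j\sigma_i\sigma_j$ if $|i-j|=1$ and $\sigma_i\sigma_j=\sigma_j\sigma_i$ if $|i-j|>1$. The square roots of free generators are $$\gamma_k=(\sigma_1\cdots\sigma_{k-1})\,\sigma_k\,(\sigma_{k-1}^{-1}\cdots\sigma_1^{-1}),\qquad k\in\mathbb N;$$ they generate $\mathbb B_\infty$. For $0<r\le t\le\infty$, $\mathbb F_{r,t}^{1/2}$ is the subgroup of $\mathbb B_\infty$ generated by $\{\gamma_s\mid r\le s\le t\}$ and $\mathbb F_{r,t}$ is the subgroup of $\mathbb B_\infty$ generated by $\{\gamma_s^2\mid r\le s\le t\}$ (for $t=\infty$, $s$ ranges over all integers $\ge r$); it is known that $\gamma_1^2,\gamma_2^2,\dots$ are free generators of a free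 group. $L(\mathbb B_\infty)$ is the group von Neumann algebra generated by the left regular representation $\sigma\mapsto L_\sigma$ on $\ell^2(\mathbb B_\infty)$, with canonical faithful normal tracial state $\mathrm{tr}_\infty$ ($\mathrm{tr}_\infty(L_\sigma)=1$ if $\sigma$ is the unit, $0$ otherwise); for a subgroup $G$, $L(G)\subset L(\mathbb B_\infty)$ is the von Neumann subalgebra generated by $L_\sigma$, $\sigma\in G$. $\bigvee$ denotes the von Neumann algebra generated. A unitary $u$ is a Haar unitary if $\mathrm{tr}_\infty(u^n)=0$ for all $n\in\mathbb Z\setminus\{0\}$. $E_{\mathcal B}$ is the trace-preserving conditional expectation onto a von Neumann subalgebra $\mathcal B$. A square of inclusions with top row $C\subset D$ and bottom row $A\subset B$ is a commuting square if $E_BE_C=E_A$. Cells of a tower are the squares formed by two consecutive rows and two consecutive columns, and also those formed with the rightmost column. Freeness and freeness with amalgamation (with respect to $\mathrm{tr}_\infty$, resp. $E_A$) are in the usual sense of Voiculescu. *)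

(* Defs.v *)
From HB Require Import structures.
From mathcomp Require Import all_boot all_order all_algebra.
From mathcomp Require Import all_classical all_reals ereal numfun esum.
From mathcomp Require Import generic_quotient.
From mathcomp Require Import complex ring.

Set Implicit Arguments.
Unset Strict Implicit.
Unset Printing Implicit Defensive.

Import Order.TTheory GRing.Theory Num.Theory ComplexField.Normc.

Local Open Scope classical_set_scope.
Local Open Scope ring_scope.

(** The letter [(i, true)] stands for the Artin generator sigma_(i+1), and
    [(i, false)] for its inverse. *)
Notation braid_word := (seq (nat * bool)).

Inductive braid_eqv : braid_word -> braid_word -> Prop :=
| braid_refl u : braid_eqv u u
| braid_sym u v : braid_eqv u v -> braid_eqv v u
| braid_trans v u w : braid_eqv u v -> braid_eqv v w -> braid_eqv u w
| braid_cat u u' v v' :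
    braid_eqv u u' -> braid_eqv v v' -> braid_eqv (u ++ v) (u' ++ v')
| braid_cancel i b : braid_eqv [:: (i, b); (i, ~~ b)] [::]
| braid_rel i j : (i == j.+1) || (j == i.+1) ->
    braid_eqv [:: (i, true); (j, true); (i, true)]
              [:: (j, true); (i, true); (j, true)]
| braid_comm i j : (i.+1 < j)%N || (j.+1 < i)%N ->
    braid_eqv [:: (i, true); (j, true)] [:: (j, true); (i, true)].

Definition braid_equivb : rel braid_word := fun u v => `[< braid_eqv u v >].

Lemma braid_equivb_refl : reflexive braid_equivb.
Proof. by move=> u; apply/asboolP; exact: braid_refl. Qed.

Lemma braid_equivb_sym : symmetric braid_equivb.
Proof. by move=> u v; apply/asbool_equiv_eq; split; exact: braid_sym. Qed.

Lemma braid_equivb_trans : transitive braid_equivb.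
Proof.
move=> v u w /asboolP uv /asboolP vw; apply/asboolP; exact: braid_trans uv vw.
Qed.

Canonical braid_equiv_rel :=
  EquivRel braid_equivb braid_equivb_refl braid_equivb_sym braid_equivb_trans.

Definition braid : Type := {eq_quot braid_equivb}%qT.
HB.instance Definition _ := Choice.on braid.
HB.instance Definition _ : EqQuotient _ braid_equivb braid :=
  EqQuotient.on braid.

Definition braid_class (w : braid_word) : braid := \pi_braid%qT w.

Lemma braid_classP u v : braid_class u = braid_class v <-> braid_eqv u v.
Proof.
split=> [/eqmodP /asboolP //|uv]; apply/eqmodP; exact/asboolP.
Qed.

Lemma braid_class_repr (x : braid) : braid_class (repr x) = x.
Proof. exact: reprK. Qed.

Lemma braid_repr_class w : braid_eqv (repr (braid_class w)) w.
Proof. by apply/braid_classP; rewrite braid_class_repr. Qed.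

Definition braid_word_inv (w : braid_word) : braid_word :=
  rev [seq (l.1, ~~ l.2) | l <- w].

Lemma braid_word_mulV w : braid_eqv (w ++ braid_word_inv w) [::].
Proof.
elim: w => [|[i b] w IHw]; first exact: braid_refl.
have -> : ((i, b) :: w) ++ braid_word_inv ((i, b) :: w)
    = [:: (i, b)] ++ ((w ++ braid_word_inv w) ++ [:: (i, ~~ b)]).
  by rewrite /braid_word_inv /= rev_cons -cats1 -!catA.
apply: braid_trans (braid_cancel i b).
rewrite -[X in braid_eqv _ X]/([:: (i, b)] ++ ([::] ++ [:: (i, ~~ b)])).
apply: braid_cat; first exact: braid_refl.
by apply: braid_cat; [exact: IHw | exact: braid_refl].
Qed.

Lemma braid_word_invK : involutive braid_word_inv.
Proof.
move=> w; rewrite /braid_word_inv map_rev revK -map_comp map_id_in//.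
by move=> [i b] _ /=; rewrite negbK.
Qed.

Lemma braid_word_mulVl w : braid_eqv (braid_word_inv w ++ w) [::].
Proof. by rewrite -{2}[w]braid_word_invK; exact: braid_word_mulV. Qed.

Lemma braid_word_inv_eqv u v :
  braid_eqv u v -> braid_eqv (braid_word_inv u) (braid_word_inv v).
Proof.
move=> uv; apply: (@braid_trans (braid_word_inv u ++ (v ++ braid_word_inv v))).
  rewrite -[X in braid_eqv X _]cats0.
  apply: braid_cat; first exact: braid_refl.
  by apply: braid_sym; exact: braid_word_mulV.
rewrite catA -[X in braid_eqv _ X]cat0s.
apply: braid_cat; last exact: braid_refl.
apply: braid_trans (braid_word_mulVl u).
by apply: braid_cat; [exact: braid_refl | exact: braid_sym].
Qed.

Definition braid_mul (x y : braid) : braid := braid_class (repr x ++ repr y).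
Definition braid_one : braid := braid_class [::].
Definition braid_inv (x : braid) : braid :=
  braid_class (braid_word_inv (repr x)).

Lemma braid_mulE u v :
  braid_mul (braid_class u) (braid_class v) = braid_class (u ++ v).
Proof. by apply/braid_classP; apply: braid_cat; exact: braid_repr_class. Qed.

Lemma braid_invE u : braid_inv (braid_class u) = braid_class (braid_word_inv u).
Proof.
by apply/braid_classP; apply: braid_word_inv_eqv; exact: braid_repr_class.
Qed.

Lemma braid_mulA : associative braid_mul.
Proof.
move=> x y z; rewrite -(braid_class_repr x) -(braid_class_repr y).
by rewrite -(braid_class_repr z) !braid_mulE catA.
Qed.

Lemma braid_mul1 : left_id braid_one braid_mul.
Proof. by move=> x; rewrite -(braid_class_repr x) braid_mulE cat0s. Qed.

Lemma braid_mulr1 : right_id braid_one braid_mul.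
Proof. by move=> x; rewrite -(braid_class_repr x) braid_mulE cats0. Qed.

Lemma braid_mulV : left_inverse braid_one braid_inv braid_mul.
Proof.
move=> x; rewrite -(braid_class_repr x) braid_invE braid_mulE.
by apply/braid_classP; exact: braid_word_mulVl.
Qed.

Lemma braid_mulrV : right_inverse braid_one braid_inv braid_mul.
Proof.
move=> x; rewrite -(braid_class_repr x) braid_invE braid_mulE.
by apply/braid_classP; exact: braid_word_mulV.
Qed.

HB.instance Definition _ := isGroup.Build braid
  braid_mulA braid_mul1 braid_mulr1 braid_mulV braid_mulrV.

(** Indices start at 1; the value at index 0 is meaningless. *)
Definition sigma (i : nat) : braid := braid_class [:: (i.-1, true)].

Definition gamma (k : nat) : braid :=
  ((\prod_(1 <= i < k) sigma i) * sigma k * (\prod_(1 <= i < k) sigma i)^-1)%g.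

Definition is_subgroup (G : groupType) (H : set G) : Prop :=
  H 1%g /\ forall x y, H x -> H y -> H (x * y^-1)%g.

Definition gen_subgroup (G : groupType) (S : set G) : set G :=
  smallest (@is_subgroup G) S.

(** An upper bound [t : option nat] is infinite when it is [None]. *)
Definition le_ext (r : nat) (t : option nat) : bool :=
  if t is Some n then (r <= n)%N else true.

Definition index_range (r : nat) (t : option nat) : set nat :=
  [set s | (r <= s)%N && le_ext s t].

Definition half_free_subgroup (r : nat) (t : option nat) : set braid :=
  gen_subgroup [set gamma s | s in index_range r t].

Definition free_subgroup (r : nat) (t : option nat) : set braid :=
  gen_subgroup [set (gamma s ^+ 2)%g | s in index_range r t].

Section ell2.
Variables (R : realType) (G : groupType).
Local Notation C := (R[i]).

Definition ell2_mass (f : G -> C) : \bar R :=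
  \esum_(x in [set: G]) (normc (f x) ^+ 2)%:E.

Definition square_summable : {pred G -> C} :=
  fun f => `[< (ell2_mass f < +oo)%E >].

Lemma esumZl_le (c : R) (F : G -> \bar R) : 0 <= c -> (forall x, (0 <= F x)%E) ->
  (\esum_(x in [set: G]) (c%:E * F x) <= c%:E * \esum_(x in [set: G]) F x)%E.
Proof.
move=> c0 F0; apply: ge_ereal_sup => _ [A [Afin _] <-].
rewrite -ge0_mule_fsumr// lee_wpmul2l// ?lee_fin// -esum_fset//.
rewrite esum_mkcond; apply: le_esum => x _; case: ifP => //.
Qed.

Lemma square_summable_closed : submod_closed square_summable.
Proof.
have sq_ge0 (f : G -> C) x : (0 <= (normc (f x) ^+ 2)%:E :> \bar R)%E.
  by rewrite lee_fin sqr_ge0.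
have n0 (z : C) : 0 <= normc z by case: z => ? ?; exact: sqrtr_ge0.
split.
  apply/asboolP; rewrite /ell2_mass esum1 ?ltry// => x _.
  by rewrite normc0 expr0n.
move=> a f g /asboolP ff /asboolP gf; apply/asboolP.
have c0 : 0 <= 2 * normc a ^+ 2 by rewrite mulr_ge0// sqr_ge0.
apply: (@le_lt_trans _ _
    (\esum_(x in [set: G]) (((2 * normc a ^+ 2)%:E * (normc (f x) ^+ 2)%:E)
       + (2%:E * (normc (g x) ^+ 2)%:E)))%E).
  apply: le_esum => x _; rewrite -!EFinM -EFinD lee_fin.
  have -> : (a *: f + g) x = a * f x + g x by [].
  apply: (@le_trans _ _ ((normc a * normc (f x) + normc (g x)) ^+ 2)).
    rewrite ler_pXn2r ?nnegrE ?addr_ge0 ?mulr_ge0//.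
    by rewrite -normcM; exact: le_normcD.
  rewrite -mulrA -exprMn -mulrDr.
  set u := _ * normc (f x); set v := normc (g x).
  rewrite -subr_ge0 (_ : _ - _ = (u - v) ^+ 2) ?sqr_ge0//.
  by rewrite sqrrD sqrrB mulrDr !mulr2n !mulrDl !mul1r; ring.
rewrite esumD => [|x _|x _]; last 2 first.
- by rewrite mule_ge0.
- by rewrite mule_ge0// lee_fin.
apply: (@le_lt_trans _ _ ((2 * normc a ^+ 2)%:E * ell2_mass f
                          + 2%:E * ell2_mass g)%E).
  by apply: leeD; apply: esumZl_le.
by rewrite lte_add_pinfty// lte_mul_pinfty// lee_fin.
Qed.

HB.instance Definition _ := GRing.isSubmodClosed.Build C (G -> C)
  square_summable square_summable_closed.

Record ell2 : Type := Ell2 {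
  ell2_val :> G -> C;
  ell2_valP : ell2_val \in square_summable }.

HB.instance Definition _ := [isSub for ell2_val].
HB.instance Definition _ := [Choice of ell2 by <:].
HB.instance Definition _ := [SubChoice_isSubLmodule of ell2 by <:].

Definition ell2_norm (f : ell2) : R := Num.sqrt (fine (ell2_mass f)).

(** Meaningful for absolutely summable families only. *)
Definition real_sum (h : G -> R) : R :=
  fine (\esum_(x in [set: G]) (h^\+ x)%:E)
  - fine (\esum_(x in [set: G]) (h^\- x)%:E).

Definition complex_sum (h : G -> C) : C :=
  Complex (real_sum (fun x => complex.Re (h x)))
    (real_sum (fun x => complex.Im (h x))).

Definition ell2_dot (f g : ell2) : C :=
  complex_sum (fun x => f x * (g x)^*%C).

Lemma ell2_delta_subproof (a : G) :
  (fun x => (x == a)%:R : C) \in square_summable.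
Proof.
apply/asboolP; rewrite /ell2_mass.
rewrite (_ : esum _ _ = \esum_(x in [set a]) (1%:E : \bar R))%E.
  by rewrite esum_set1 ?ltry// lee_fin.
rewrite [RHS]esum_mkcond; apply: eq_esum => x _.
case: (eqVneq x a) => [->|/eqP xa]; first by rewrite mem_set// normc1 expr1n.
by rewrite memNset// normc0 expr0n.
Qed.

Definition ell2_delta (a : G) : ell2 := Ell2 (ell2_delta_subproof a).

Lemma lregular_subproof (s : G) (f : ell2) :
  (fun x => f (s^-1 * x)%g) \in square_summable.
Proof.
apply/asboolP; have /asboolP := ell2_valP f; rewrite /ell2_mass.
rewrite (reindex_esum setT setT (fun x => s^-1 * x)%g)//.
split=> [x//|x y _ _ /mulgI//|x _].
by exists (s * x)%g => //; exact: mulKg.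
Qed.

Definition lregular (s : G) (f : ell2) : ell2 := Ell2 (lregular_subproof s f).

End ell2.

Arguments lregular R {G} s f.

Section VonNeumann.
Variables (R : realType) (G : groupType).
Local Notation C := (R[i]).
Local Notation op := (ell2 R G -> ell2 R G).
Implicit Types (T U : op) (M A B : set op).

Definition bounded_op T : Prop :=
  (forall (a : C) f g, T (a *: f + g) = a *: T f + T g) /\
  exists c : R, forall f, ell2_norm (T f) <= c * ell2_norm f.

Definition is_adjoint T U : Prop :=
  forall f g, ell2_dot (T f) g = ell2_dot f (U g).

Definition commutant (S : set op) : set op :=
  [set T | bounded_op T /\ forall U, S U -> T \o U = U \o T].

Definition is_vna M : Prop :=
  [/\ M `<=` bounded_op,
      forall T U, M T -> is_adjoint T U -> M U
    & commutant (commutant M) = M].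

Definition gen_vna (S : set op) : set op := smallest is_vna S.

Definition is_star_subalgebra A : Prop :=
  [/\ A `<=` bounded_op,
      A idfun,
      forall (a : C) T U, A T -> A U -> A (a *: T + U),
      forall T U, A T -> A U -> A (T \o U)
    & forall T U, A T -> is_adjoint T U -> A U].

Definition gen_star_subalgebra (S : set op) : set op :=
  smallest is_star_subalgebra S.

Definition scalar_ops : set op := [set a *: (idfun : op) | a in [set: C]].

Definition group_vna (H : set G) : set op := gen_vna (lregular R @` H).

Definition vtrace T : C :=
  ell2_dot (T (ell2_delta R 1%g)) (ell2_delta R 1%g).

Definition is_unitary T U : Prop :=
  [/\ bounded_op T, is_adjoint T U, T \o U = idfun & U \o T = idfun].

(** [unitary_power T U n] is T^n when U is the inverse of T. *)
Definition unitary_power T U (n : int) : op :=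
  match n with Posz k => iter k T | Negz k => iter k.+1 U end.

Definition haar_unitary T : Prop :=
  exists2 U, is_unitary T U
    & forall n : int, n != 0 -> vtrace (unitary_power T U n) = 0.

Definition positive_op T : Prop := forall f, 0 <= ell2_dot (T f) f.

(** [E] is the trace-preserving conditional expectation of [M] onto [B]; its
    values outside [M] are irrelevant. *)
Definition is_cond_exp M B (E : op -> op) : Prop :=
  [/\ (forall T, M T -> B (E T)) /\ (forall T, B T -> E T = T),
      forall (a : C) T U, M T -> M U -> E (a *: T + U) = a *: E T + E U,
      forall S T U, B S -> M T -> B U -> E (S \o T \o U) = S \o E T \o U,
      forall T, M T -> positive_op T -> positive_op (E T)
    & forall T, M T -> vtrace (E T) = vtrace T].

Definition commuting_square M (A B C D : set op) : Prop :=
  [/\ A `<=` B, C `<=` D, A `<=` C, B `<=` D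
    & exists EA EB EC : op -> op,
      [/\ is_cond_exp M A EA, is_cond_exp M B EB, is_cond_exp M C EC
        & forall T, M T -> EB (EC T) = EA T]].

(** Freeness of the family [B] with respect to [phi]: alternating products of
    [phi]-centred elements are [phi]-centred.  With [phi] the trace this is
    free independence, with [phi] a conditional expectation onto a common
    subalgebra it is free independence with amalgamation. *)
Definition free_wrt (V : nmodType) (phi : op -> V) (I : eqType)
    (B : I -> set op) : Prop :=
  forall (n : nat) (i : nat -> I) (x : nat -> op),
    (forall k, (k <= n)%N -> B (i k) (x k) /\ phi (x k) = 0) ->
    (forall k, (k < n)%N -> i k != i k.+1) ->
    phi (\big[(fun T U => T \o U) / idfun]_(k < n.+1) x k) = 0.

Definition free_amalgamated M A B C : Prop :=
  [/\ A `<=` B, A `<=` C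
    & exists2 EA : op -> op, is_cond_exp M A EA
      & free_wrt EA (fun b : bool => if b then B else C)].

(** The algebra in row [r >= 1] and column [t >= r - 1] ([None] for the
    rightmost column); the leftmost entry of each row is the scalars. *)
Definition tower (N : nat -> option nat -> set op) (r : nat) (t : option nat) :
    set op :=
  if le_ext r t then N r t else scalar_ops.

Definition tower_inclusions (T : nat -> option nat -> set op) : Prop :=
  (forall r c, (0 < r)%N -> (r <= c.+1)%N ->
     T r (Some c) `<=` T r (Some c.+1) /\ T r (Some c) `<=` T r None) /\
  (forall r t, (0 < r)%N -> le_ext r t -> T r.+1 t `<=` T r t).

(** Each cell is passed to [P] in the order bottom left, bottom right, top left,
    top right. *)
Definition tower_cells (T : nat -> option nat -> set op)
    (P : set op -> set op -> set op -> set op -> Prop) : Prop :=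
  forall (r c : nat) (c' : option nat),
    (0 < r)%N -> (r <= c)%N -> c' = Some c.+1 \/ c' = None ->
    P (T r.+1 (Some c)) (T r.+1 c') (T r (Some c)) (T r c').

End VonNeumann.

Arguments group_vna R {G} H.
Arguments vtrace R {G} T.

(* Main.v *)
Require Import Defs.
From HB Require Import structures.
From mathcomp Require Import all_boot all_order all_algebra.
From mathcomp Require Import all_classical all_reals.
From mathcomp Require Import complex.
From mathcomp Require Import ereal numfun esum.
From mathcomp Require Import zify ring lra.

Set Implicit Arguments.
Unset Strict Implicit.
Unset Printing Implicit Defensive.

Local Open Scope classical_set_scope.

(** Every assertion is reduced to one about subgroups of the braid group.

    For a subgroup H the algebra L(H) consists of the bounded operators T that
    commute with the right translations and whose symbol T delta_1 is supported
    on H: such a T is the left convolution by its symbol, hence commutes with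
    whatever commutes with the L_h, h in H ([group_vnaE]).  In terms of symbols
    the conditional expectation onto L(H) is the restriction to H, that is the
    compression of T to its diagonal blocks along the right cosets of H
    ([is_cond_exp_cond_exp]).  Therefore E_H E_K = E_(H cap K), and a square of
    group algebras commutes as soon as the lower left group is the intersection
    of its two neighbours.  Moreover the symbol of a product is supported on the
    product of the supports, so that freeness, with or without amalgamation,
    only requires alternating products of group elements lying outside the
    amalgam to stay outside of it ([free_wrt_convolvers]).

    For the first tower, conjugation by sigma_1 ... sigma_(r-1) turns the
    subgroup generated by gamma_r, ..., gamma_t into the parabolic subgroup
    generated by sigma_r, ..., sigma_t, and it has to be shown that the
    parabolic subgroups of sigma_r, sigma_(r+1), ... and of
    sigma_1, ..., sigma_c meet in the one of sigma_r, ..., sigma_c.  Forget all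
    strands but the first c+1: this is well defined on braids, leaves a braid in
    sigma_1, ..., sigma_c unchanged, and sends a word in sigma_r, sigma_(r+1),
    ... to a word in sigma_r, ..., sigma_c ([parabolic_cap]).

    For the second tower the gamma_s^2 have to be free generators.  The braid
    group acts on sequences over a rack by Hurwitz moves.  In the rack made of
    the reduced words and of the bijections between them, gamma_s^2 carries a
    word around the bijection that adds the letter s, so that a reduced word
    can be read off from the action of its value ([free_val_inj]).  The normal
    form of amalgamated products then follows by cancelling letters
    ([free_amalgam]). *)

(** * Hurwitz moves on sequences over a rack *)

Section Hurwitz.
Variables (R : Type) (op opV : R -> R -> R).

(** The elementary move replaces neighbours (x, y) by (x > y, x), where > is the
    operation of the rack; the words act on the right, first letter first. *)
Definition hurwitz_letter (l : nat * bool) (s : nat -> R) : nat -> R :=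
  let: (i, b) := l in fun j =>
  if j == i then (if b then op (s i) (s i.+1) else s i.+1)
  else if j == i.+1 then (if b then s i else opV (s i.+1) (s i))
  else s j.

Definition hurwitz (w : braid_word) (s : nat -> R) : nat -> R :=
  foldl (fun s l => hurwitz_letter l s) s w.

Lemma hurwitz_cat u v s : hurwitz (u ++ v) s = hurwitz v (hurwitz u s).
Proof. exact: foldl_cat. Qed.

Definition is_rack : Prop :=
  [/\ forall x y, opV x (op x y) = y, forall x y, op x (opV x y) = y
    & forall x y z, op x (op y z) = op (op x y) (op x z)].

(** Invertibility of the operation gives the cancellation relation, and
    self-distributivity is exactly the braid relation. *)
Lemma hurwitz_eqv u v s : is_rack -> braid_eqv u v -> hurwitz u s = hurwitz v s.
Proof.
move=> [opK opVK opD] uv; elim: uv s => {u v}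
  [//|u v _ IH s|u v w _ IH1 _ IH2 s|u u' v v' _ IH1 _ IH2 s|i b s|i j|i j ij
    s].
- by rewrite IH.
- by rewrite IH1.
- by rewrite !hurwitz_cat IH1 IH2.
- have E1 : (i.+1 == i) = false by lia.
  have E2 : (i == i.+1) = false by lia.
  apply/funext => j; rewrite /hurwitz /=.
  case: (j =P i) => [->|ji]; first by case: b; rewrite !(E1, E2, eqxx) /= ?opVK.
  case: (j =P i.+1) => [->|ji1]; first by case: b;
    rewrite !(E1, E2, eqxx) /= ?opK.
  by case: b.
- suff H k s : hurwitz [:: (k, true); (k.+1, true); (k, true)] s
      = hurwitz [:: (k.+1, true); (k, true); (k.+1, true)] s.
    by case/orP=> /eqP -> s; rewrite H.
  move=> {i j}; apply/funext => j; rewrite /hurwitz /=.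
  have E1 : (k.+1 == k) = false by lia.
  have E2 : (k == k.+1) = false by lia.
  have E3 : (k.+2 == k) = false by lia.
  have E4 : (k.+2 == k.+1) = false by lia.
  have E5 : (k == k.+2) = false by lia.
  have E6 : (k.+1 == k.+2) = false by lia.
  case: (j =P k) => [E|jk]; first by rewrite ?E ?(E1, E2, E3, E4, E5, E6, eqxx)
    -opD.
  case: (j =P k.+1) => [E|jk1];
    first by rewrite ?E ?(E1, E2, E3, E4, E5, E6, eqxx).
  case: (j =P k.+2) => [E|jk2];
    first by rewrite ?E ?(E1, E2, E3, E4, E5, E6, eqxx).
  by [].
- apply/funext => k; rewrite /hurwitz /=.
  have E1 : (j == i) = false by lia.
  have E2 : (j == i.+1) = false by lia.
  have E3 : (j.+1 == i) = false by lia.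
  have E4 : (j.+1 == i.+1) = false by lia.
  have E5 : (i == j) = false by lia.
  have E6 : (i == j.+1) = false by lia.
  have E7 : (i.+1 == j) = false by lia.
  have E8 : (i.+1 == j.+1) = false by lia.
  case: (k =P i) => [E|ki]; first by rewrite ?E ?(E1,E2,E3,E4,E5,E6,E7,E8,eqxx).
  case: (k =P i.+1) => [E|ki1];
    first by rewrite ?E ?(E1,E2,E3,E4,E5,E6,E7,E8,eqxx).
  case: (k =P j) => [E|kj]; first by rewrite ?E ?(E1,E2,E3,E4,E5,E6,E7,E8,eqxx).
  by case: (k =P j.+1) => [E|kj1]; rewrite ?E ?(E1,E2,E3,E4,E5,E6,E7,E8,eqxx).
Qed.

Definition hurwitz_act (g : braid) s := hurwitz (repr g) s.

Hypothesis rackP : is_rack.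

Lemma hurwitz_act_class w s : hurwitz_act (braid_class w) s = hurwitz w s.
Proof. exact/hurwitz_eqv/braid_repr_class. Qed.

Lemma hurwitz_actM x y s : hurwitz_act (x * y)%g s =
  hurwitz_act y (hurwitz_act x s).
Proof.
rewrite -(braid_class_repr x) -(braid_class_repr y).
by rewrite [(_ * _)%g]braid_mulE !hurwitz_act_class hurwitz_cat.
Qed.

Lemma hurwitz_act1 s : hurwitz_act 1%g s = s.
Proof. by rewrite (_ : 1%g = braid_class [::]) ?hurwitz_act_class. Qed.

Lemma hurwitz_actK x s : hurwitz_act x^-1%g (hurwitz_act x s) = s.
Proof. by rewrite -hurwitz_actM mulgV hurwitz_act1. Qed.

End Hurwitz.

Arguments hurwitz : simpl never.

(** * Forgetting strands *)

Lemma flip_rack (R : Type) : is_rack (fun _ y : R => y) (fun _ y => y).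
Proof. by []. Qed.

(** For the trivial operation the moves just permute the entries; on the
    indicator of a set of positions they follow the strands starting there. *)
Notation flip_strands := (hurwitz (fun _ y => y) (fun _ y => y)).

Fixpoint rank (X : nat -> bool) (i : nat) : nat :=
  if i is k.+1 then rank X k + X k else 0.

(** The braid formed by the strands that start in [X]: a crossing survives when
    both of its strands are kept, at the position that its left strand has among
    the kept ones. *)
Fixpoint forget (X : nat -> bool) (w : braid_word) : braid_word :=
  if w is (i, b) :: w' then
    (if X i && X i.+1 then [:: (rank X i, b)] else [::])
      ++ forget (flip_strands [:: (i, b)] X) w'
  else [::].

Lemma forget_cat X u v :
  forget X (u ++ v) = forget X u ++ forget (flip_strands u X) v.
Proof. by elim: u X => [//|[i b] u IH] X /=; rewrite IH catA. Qed.

Lemma flip_stepE i b (X : nat -> bool) :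
  [/\ flip_strands [:: (i, b)] X i = X i.+1,
      flip_strands [:: (i, b)] X i.+1 = X i
    & forall j, j <> i -> j <> i.+1 -> flip_strands [:: (i, b)] X j = X j].
Proof.
rewrite /hurwitz /= eqxx (_ : (i.+1 == i) = false) ?eqxx; last lia.
split; [by case: b | by case: b|].
by move=> j /eqP/negbTE -> /eqP/negbTE ->.
Qed.

Lemma rank_flip_le i b X j : (j <= i)%N ->
  rank (flip_strands [:: (i, b)] X) j = rank X j.
Proof.
elim: j => [//|j IH] ji; rewrite [LHS]/= [RHS]/= IH; last lia.
by have [_ _ ->] := flip_stepE i b X; lia.
Qed.

Lemma rank_flip_ge i b X j : (i.+2 <= j)%N ->
  rank (flip_strands [:: (i, b)] X) j = rank X j.
Proof.
elim: j => [//|j IH]; rewrite leq_eqVlt => /orP[/eqP[<-]|ij].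
  rewrite [LHS]/= [RHS]/= rank_flip_le //; have [-> -> _] := flip_stepE i b X.
  by rewrite -!addnA [(X i + _)%N]addnC.
rewrite [LHS]/= [RHS]/= IH //.
by have [_ _ ->] := flip_stepE i b X; lia.
Qed.

(** In a braid relation each two of the three strands cross once on either side.
    Keeping all three strands gives a braid relation again, keeping two of them
    leaves the same single crossing on both sides, and keeping at most one
    leaves none. *)
Lemma forget_eqv X u v : braid_eqv u v -> braid_eqv (forget X u) (forget X v).
Proof.
move=> uv; elim: uv X => {u v}
  [u|u v _ IH|u v w _ IH1 _ IH2|u u' v v' uu' IH1 vv' IH2|i b|i j ij|i j ij] X.
- exact: braid_refl.
- exact: braid_sym.
- exact: braid_trans (IH1 X) (IH2 X).
- rewrite !forget_cat; apply: braid_cat => //.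
  by rewrite (hurwitz_eqv _ (flip_rack bool) uu').
- rewrite [forget _ _]/=.
  have [-> -> _] := flip_stepE i b X; rewrite rank_flip_le // andbC.
  case: ifP => _; last exact: braid_refl.
  exact: braid_cancel.
- have H k Y : braid_eqv (forget Y [:: (k, true); (k.+1, true); (k, true)])
      (forget Y [:: (k.+1, true); (k, true); (k.+1, true)]).
    rewrite [forget _ _]/= [X in braid_eqv _ X]/=.
    set X1 := flip_strands [:: (k, true)] Y.
    set X2 := flip_strands [:: (k.+1, true)] X1.
    set Z1 := flip_strands [:: (k.+1, true)] Y.
    set Z2 := flip_strands [:: (k, true)] Z1.
    have [x10 x11 x1] := flip_stepE k true Y.
    have [x21 x22 x2] := flip_stepE k.+1 true X1.
    have [z11 z12 z1] := flip_stepE k.+1 true Y.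
    have [z20 z21 z2] := flip_stepE k true Z1.
    have e1 : rank Z1 k = rank Y k by rewrite rank_flip_le.
    have e3 : rank X1 k = rank Y k by rewrite rank_flip_le.
    have e2 : rank X2 k = rank Y k by rewrite rank_flip_le.
    have e4 : rank Z2 k = rank Y k by rewrite rank_flip_le.
    have [k1 k2 k3 k4] : [/\ k <> k.+1, k <> k.+2, k.+2 <> k & k.+2 <> k.+1].
      by clear; split; lia.
    have {x2 z1 x1 z2} [x2k z1k x1k z2k] : [/\ X2 k = X1 k, Z1 k = Y k,
        X1 k.+2 = Y k.+2 & Z2 k.+2 = Z1 k.+2].
      by split; [apply: x2|apply: z1|apply: x1|apply: z2].
    rewrite -/X1 -/X2 -/Z1 -/Z2 in x10 x11 x21 x22 z11 z12 z20 z21.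
    rewrite e1 e2 e3 e4.
    rewrite z20 z21 z2k x2k x21 x1k x10 x11 z11 z12 z1k.
    have := @braid_rel (rank Y k) (rank Y k).+1 ltac:(by rewrite eqxx orbT).
    by case: (Y k) (Y k.+1) (Y k.+2) => [] [] [] //=;
      rewrite ?addn0 ?addn1 // => _; exact: braid_refl.
  by case/orP: ij => /eqP ->; [apply: braid_sym|]; exact: H.
- have H k l Y : (k.+1 < l)%N -> braid_eqv (forget Y [:: (k, true); (l, true)])
      (forget Y [:: (l, true); (k, true)]).
    move=> kl; rewrite [forget _ _]/= [X in braid_eqv _ X]/=.
    rewrite rank_flip_ge // rank_flip_le; last lia.
    have [_ _ x] := flip_stepE k true Y; have [_ _ y] := flip_stepE l true Y.
    rewrite !x ?y; try lia.
    have rk m n : (m <= n)%N -> (rank Y m <= rank Y n)%N.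
      by elim: n => [|n IH]; rewrite leq_eqVlt => /orP[/eqP->//|] //= /IH; lia.
    case: ifP => Ek; case: ifP => El; try exact: braid_refl.
    apply: braid_comm; apply/orP; left.
    by have := rk k.+2 l kl; move/andP: Ek => /= [-> ->]; lia.
  by case/orP: ij => ij; [|apply: braid_sym]; exact: H.
Qed.

(** * Parabolic subgroups *)

Section Subgroups.
Variable G : groupType.
Implicit Types (H S : set G) (x y : G).

Lemma subgroup1 H : is_subgroup H -> H 1%g. Proof. by case. Qed.

Lemma subgroupV H x : is_subgroup H -> H x -> H x^-1%g.
Proof. by move=> [H1 HV] Hx; rewrite -[x^-1%g]mul1g; exact: HV. Qed.

Lemma subgroupM H x y : is_subgroup H -> H x -> H y -> H (x * y)%g.
Proof.
by move=> HG Hx Hy; rewrite -[y]invgK; apply: HG.2 => //; exact: subgroupV.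
Qed.

Lemma subgroup_prod H (I : Type) (s : seq I) (P : pred I) (F : I -> G) :
  is_subgroup H -> (forall i, P i -> H (F i)) -> H (\prod_(i <- s | P i) F i)%g.
Proof.
move=> HG HF; elim: s => [|i s IH]; first by rewrite big_nil; exact: subgroup1.
by rewrite big_cons; case: ifP => // Pi; apply: subgroupM => //; exact: HF.
Qed.

Lemma gen_subgroup_subgroup S : is_subgroup (gen_subgroup S).
Proof.
split=> [H [[H1 _] _] //|x y Sx Sy H [HG SH]].
by apply: HG.2; [apply: Sx|apply: Sy].
Qed.

Lemma gen_subgroup_gen S : S `<=` gen_subgroup S.
Proof. exact: sub_smallest. Qed.

Lemma gen_subgroup_min S H : is_subgroup H -> S `<=` H -> gen_subgroup S `<=` H.
Proof. by move=> HG SH; exact: smallest_sub. Qed.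

Lemma gen_subgroup_mono S T : S `<=` T -> gen_subgroup S `<=` gen_subgroup T.
Proof.
move=> ST; apply: gen_subgroup_min; first exact: gen_subgroup_subgroup.
by apply: subset_trans ST _; exact: gen_subgroup_gen.
Qed.

Lemma subgroup_conj H (w : G) : is_subgroup H ->
  is_subgroup [set x | H (x ^ w)%g].
Proof.
move=> HG; split=> [/=|x y /= Hx Hy]; first by rewrite conj1g; exact: subgroup1.
by rewrite conjMg conjVg; apply: HG.2.
Qed.

End Subgroups.

Definition parabolic (r : nat) (t : option nat) : set braid :=
  gen_subgroup [set sigma s | s in index_range r t].

Definition letters_in (r : nat) (t : option nat) : pred braid_word :=
  all (fun l : nat * bool => (r <= l.1.+1)%N && le_ext l.1.+1 t).

Lemma parabolic_word r t x : (0 < r)%N -> parabolic r t x ->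
  exists2 w, letters_in r t w & x = braid_class w.
Proof.
move=> r0.
suff: parabolic r t `<=` [set x | exists2 w, letters_in r t w & x =
  braid_class w].
  exact.
apply: gen_subgroup_min.
  split; first by exists [::].
  move=> _ _ [u hu ->] [v hv ->]; exists (u ++ braid_word_inv v).
    rewrite /letters_in all_cat; apply/andP; split=> //.
    by rewrite all_rev all_map; apply: sub_all hv.
  by rewrite -[in RHS]braid_mulE -braid_invE.
move=> _ [s /andP[rs st] <-]; exists [:: (s.-1, true)] => //.
by rewrite /letters_in /= prednK ?rs ?st //; lia.
Qed.

Lemma parabolic_class r t w : letters_in r t w -> parabolic r t (braid_class w).
Proof.
have PG : is_subgroup (parabolic r t) by exact: gen_subgroup_subgroup.
elim: w => [_|[i b] w IH /= /andP[ri wP]]; first exact: (subgroup1 PG).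
have -> : braid_class ((i, b) :: w) =
  (braid_class [:: (i, b)] * braid_class w)%g.
  by rewrite [RHS]braid_mulE.
apply: (subgroupM PG); last exact: IH.
have Ps : parabolic r t (sigma i.+1) by apply: gen_subgroup_gen; exists i.+1.
case: b => //; rewrite (_ : braid_class _ = (sigma i.+1)^-1%g).
  exact: (subgroupV PG Ps).
by rewrite [RHS]braid_invE.
Qed.

Lemma forget_id c w : letters_in 1 (Some c) w ->
  forget (fun j => (j <= c)%N) w = w.
Proof.
have rk i : (i <= c.+1)%N -> rank (fun j => (j <= c)%N) i = i.
  by elim: i => //= i IH ic; rewrite IH ?(ltnW ic) // -ltnS ic addn1.
elim: w => // -[i b] w IH /= /andP[ic wc].
rewrite (ltnW ic) ic /= rk; last lia.
rewrite (_ : flip_strands _ _ = (fun j => (j <= c)%N)) ?IH //.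
have [f1 f2 f3] := flip_stepE i b (fun j => (j <= c)%N).
apply/funext => j; case: (j =P i) => [->|ji]; first by rewrite f1; lia.
by case: (j =P i.+1) => [->|ji1]; [rewrite f2; lia|rewrite f3].
Qed.

Lemma rank_mono X i j : (i <= j)%N -> (rank X i <= rank X j)%N.
Proof.
elim: j => [|j IH]; rewrite leq_eqVlt => /orP[/eqP->//|] //= ij.
by apply: leq_trans (IH ij) _; exact: leq_addr.
Qed.

(** The strands left of position r stay in place and are kept, which bounds the
    surviving indices from below; the number of kept strands bounds them from
    above. *)
Lemma forget_letters r c (X : nat -> bool) w : letters_in r None w ->
  (forall j, (j.+1 < r)%N -> X j) -> (forall m, rank X m <= c.+1)%N ->
  letters_in r (Some c) (forget X w).
Proof.
elim: w X => // -[i b] w IH X /= /andP[/andP[ri _] wP] Xr Xc.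
rewrite /letters_in all_cat; apply/andP; split; last first.
  have [f1 f2 f3] := flip_stepE i b X.
  apply: IH => // [j jr|m]; first by rewrite f3 ?Xr //; lia.
  have [mi|im] := leqP m i; first by rewrite rank_flip_le.
  by apply: leq_trans (rank_mono _ (leqnSn _)) _; rewrite rank_flip_ge.
case: ifP => // /andP[Xi Xi1] /=; rewrite andbT; apply/andP; split; last first.
  by have := Xc i.+2; rewrite /= Xi Xi1; lia.
have rkr k : (k < r)%N -> rank X k = k.
  by elim: k => //= k IHk kr; rewrite IHk ?Xr //; lia.
have [->//|r0] := posnP r.
have : (rank X r.-1 <= rank X i)%N by apply: rank_mono; lia.
by rewrite rkr; lia.
Qed.

(** Forgetting all strands but the first c+1 fixes a word in
    sigma_1, ..., sigma_c, while it turns an equivalent word in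
    sigma_r, sigma_(r+1), ... into one in sigma_r, ..., sigma_c. *)
Lemma parabolic_cap r c x : (0 < r)%N -> (r <= c.+1)%N ->
  parabolic r None x -> parabolic 1 (Some c) x -> parabolic r (Some c) x.
Proof.
move=> r0 rc /parabolic_word[//|u ur ->] /parabolic_word[//|v vc] /braid_classP
  uv.
have /braid_classP -> : braid_eqv u (forget (fun j => (j <= c)%N) u).
  apply: (braid_trans uv); rewrite -{1}(forget_id vc).
  exact: (forget_eqv _ (braid_sym uv)).
apply: parabolic_class; apply: forget_letters => // [j jr|m]; first lia.
suff : (rank (fun j => (j <= c)%N) m <= minn m c.+1)%N by lia.
by elim: m => //= m IH; case: leqP => mc; lia.
Qed.

Lemma parabolic_subgroup r t : is_subgroup (parabolic r t).
Proof. exact: gen_subgroup_subgroup. Qed.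

(** * The subgroups generated by the square roots *)

Lemma half_subgroup r t : is_subgroup (half_free_subgroup r t).
Proof. exact: gen_subgroup_subgroup. Qed.

Lemma index_range_mono r r' t t' : (r' <= r)%N ->
  (forall s, le_ext s t -> le_ext s t') ->
    index_range r t `<=` index_range r' t'.
Proof.
by move=> rr tt s /andP[rs st]; apply/andP; rewrite (leq_trans rr rs) tt.
Qed.

Lemma half_mono r r' t t' : (r' <= r)%N ->
  (forall s, le_ext s t -> le_ext s t') ->
  half_free_subgroup r t `<=` half_free_subgroup r' t'.
Proof.
by move=> rr tt; apply: gen_subgroup_mono; apply: image_subset; exact:
  index_range_mono.
Qed.

Definition sigma_prod (m n : nat) : braid := (\prod_(m <= i < n) sigma i)%g.

Lemma gamma_conj r k : (0 < r)%N -> (r <= k)%N ->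
  (gamma k ^ sigma_prod 1 r)%g = (sigma k ^ (sigma_prod r k)^-1)%g.
Proof.
move=> r0 rk; rewrite /gamma (_ : (\prod_(1 <= i < k) sigma i)%g
    = (sigma_prod 1 r * sigma_prod r k)%g); last first.
  by rewrite /sigma_prod -big_cat_nat.
by rewrite !conjgE invgK invgM -!mulgA mulKg !mulgA mulgVK.
Qed.

Lemma sigma_prod_parabolic r k t : (forall i, (i < k)%N -> le_ext i t) ->
  parabolic r t (sigma_prod r k).
Proof.
move=> kt; rewrite /sigma_prod big_nat_cond; apply: subgroup_prod.
  exact: parabolic_subgroup.
move=> i /andP[/andP[ri ik] _]; apply: gen_subgroup_gen; exists i => //.
by apply/andP; split=> //; exact: kt.
Qed.

(** After the conjugation gamma_k becomes the conjugate of sigma_k by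
    sigma_r ... sigma_(k-1), which lies in the parabolic subgroup; conversely
    sigma_k is recovered from it by induction on k. *)
Lemma half_parabolic r t x : (0 < r)%N ->
  half_free_subgroup r t x <-> parabolic r t (x ^ sigma_prod 1 r)%g.
Proof.
move=> r0; have PG := parabolic_subgroup r t; have HG := half_subgroup r t.
split.
  move: x; apply: gen_subgroup_min; first exact: subgroup_conj.
  move=> _ [k /andP[rk kt] <-] /=; rewrite gamma_conj // conjgE invgK.
  have Pk : parabolic r t (sigma_prod r k).
    by apply: sigma_prod_parabolic => i ik; case: (t) kt => [n|] //=; lia.
  apply: (subgroupM PG) => //; apply: (subgroupM PG); last exact:
    (subgroupV PG).
  by apply: gen_subgroup_gen; exists k => //; apply/andP.
move=> Px; rewrite -(conjgK (sigma_prod 1 r) x); move: (x ^ _)%g Px => {}x.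
move: x; apply: gen_subgroup_min; first exact: subgroup_conj.
move=> _ [k /andP[rk kt] <-] /=.
elim/ltn_ind: k rk kt => k IH rk kt.
have Vk : half_free_subgroup r t (sigma_prod r k ^ (sigma_prod 1 r)^-1)%g.
  rewrite /sigma_prod conjg_prod big_nat_cond; apply: subgroup_prod => //.
  move=> i /andP[/andP[ri ik] _]; apply: IH => //.
  by case: (t) kt => [n|] /=; lia.
have -> : sigma k = (gamma k ^ (sigma_prod 1 r * sigma_prod r k))%g.
  by rewrite conjgM gamma_conj // conjgKV.
rewrite -conjgM (_ : _ * _ = (sigma_prod r k ^ (sigma_prod 1 r)^-1))%g;
  last first.
  by rewrite conjgE invgK mulgA.
rewrite conjgE; apply: (subgroupM HG); first exact: (subgroupV HG).
apply: (subgroupM HG) => //; apply: gen_subgroup_gen; exists k => //.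
by apply/andP.
Qed.

(** Both subgroups are conjugated by sigma_1 ... sigma_r, which belongs to the
    parabolic subgroup of sigma_1, ..., sigma_c because r <= c. *)
Lemma half_cap r c x : (0 < r)%N -> (r <= c)%N ->
  half_free_subgroup r.+1 None x -> half_free_subgroup r (Some c) x ->
  half_free_subgroup r.+1 (Some c) x.
Proof.
move=> r0 rc Hr Hc; apply/half_parabolic => //.
apply: parabolic_cap => //; first by apply/(half_parabolic _ _ (ltn0Sn r)).
have /(@half_parabolic 1 _ _ isT) : half_free_subgroup 1 (Some c) x.
  by move: Hc; apply: half_mono.
rewrite {1}/sigma_prod big_nil conjg1 => Px1.
have P1 := parabolic_subgroup 1 (Some c).
have Pw : parabolic 1 (Some c) (sigma_prod 1 r.+1).
  by apply: sigma_prod_parabolic => i ir; exact: leq_trans rc.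
by rewrite conjgE; apply: (subgroupM P1);
  [apply: (subgroupV P1)|apply: (subgroupM P1)].
Qed.

(** * A rack of points and bijections *)

Record bijection (T : Type) := Bijection {
  fwd :> T -> T; bwd : T -> T; fwdK : cancel fwd bwd; bwdK : cancel bwd fwd }.

Lemma bijection_eq T (f g : bijection T) : fwd f =1 fwd g -> f = g.
Proof.
case: f g => [f f' fK f'K] [g g' gK g'K] /= /funext fg.
rewrite -{g}fg in gK g'K *.
have e : f' = g' by apply/funext => x; rewrite -{1}[x]g'K fK.
by rewrite -{g'}e in gK g'K *; congr Bijection; apply: Prop_irrelevance.
Qed.

Section PointRack.
Variable T : Type.
Implicit Types f g : bijection T.

Definition bij_inv f : bijection T := Bijection (@bwdK _ f) (@fwdK _ f).

Lemma bij_conjK f g : cancel (f \o g \o bwd f) (f \o bwd g \o bwd f).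
Proof. by move=> x /=; rewrite fwdK fwdK bwdK. Qed.

Lemma bij_conjVK f g : cancel (f \o bwd g \o bwd f) (f \o g \o bwd f).
Proof. by move=> x /=; rewrite fwdK !bwdK. Qed.

Definition bij_conj f g : bijection T :=
  Bijection (bij_conjK f g) (bij_conjVK f g).

(** Bijections act on points by evaluation and on each other by conjugation,
    whereas points act trivially.  A point that travels through a sequence of
    bijections thus records those it passes without altering them. *)
Definition point_op (x y : T + bijection T) : T + bijection T :=
  match x, y with
  | inl _, _ => y
  | inr f, inl p => inl (f p)
  | inr f, inr g => inr (bij_conj f g)
  end.

Definition point_opV (x y : T + bijection T) : T + bijection T :=
  match x with inl _ => y | inr f => point_op (inr (bij_inv f)) y end.

Lemma point_rack : is_rack point_op point_opV.
Proof.
split=> [[p|f] [q|g]|[p|f] [q|g]|[p|f] [q|g] [o|h]] //=.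
all: try by rewrite ?fwdK ?bwdK.
all: by congr inr; apply: bijection_eq => x /=; rewrite ?fwdK ?bwdK.
Qed.

End PointRack.

(** * Reduced words *)

Definition inv_letter (l : nat * bool) : nat * bool := (l.1, ~~ l.2).

Lemma inv_letterK : involutive inv_letter.
Proof. by case=> i b; rewrite /inv_letter /= negbK. Qed.

Definition reduced (w : braid_word) : bool :=
  sorted (fun l m => m != inv_letter l) w.

Definition push (l : nat * bool) (w : braid_word) : braid_word :=
  if w is m :: w' then if m == inv_letter l then w' else l :: w else [:: l].

Lemma push_reduced l w : reduced w -> reduced (push l w).
Proof.
case: w => // m w; rewrite /push; case: ifP => [_|ml]; first exact: path_sorted.
by move=> mw; rewrite /reduced /= ml.
Qed.

Lemma pushK l w : reduced w -> push (inv_letter l) (push l w) = w.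
Proof.
case: w => [_|m w]; first by rewrite /push inv_letterK eqxx.
rewrite {2}/push; case: eqP => [->|_] mw;
  last by rewrite /push inv_letterK eqxx.
case: w mw => [|n w] //= /andP[].
by rewrite inv_letterK => /negbTE ->.
Qed.

Lemma pushVK l w : reduced w -> push l (push (inv_letter l) w) = w.
Proof. by rewrite -{1}[l]inv_letterK; exact: pushK. Qed.

Notation reduced_word := {w : braid_word | reduced w}.

Definition rpush (l : nat * bool) (w : reduced_word) : reduced_word :=
  exist _ (push l (sval w)) (push_reduced l (svalP w)).

Lemma rpushK l : cancel (rpush l) (rpush (inv_letter l)).
Proof. by move=> w; apply: val_inj; exact: pushK (svalP w). Qed.

Lemma rpushVK l : cancel (rpush (inv_letter l)) (rpush l).
Proof. by move=> w; apply: val_inj; exact: pushVK (svalP w). Qed.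

Definition push_bij (s : nat) : bijection reduced_word :=
  Bijection (@rpushK (s, true)) (@rpushVK (s, true)).

Definition empty_word : reduced_word := exist _ [::] isT.

(** * The squares of the generators are free *)

Definition gamma_sq_letter (l : nat * bool) : braid :=
  if l.2 then (gamma l.1 ^+ 2)%g else (gamma l.1 ^+ 2)^-1%g.

Definition free_val (w : braid_word) : braid :=
  (\prod_(l <- w) gamma_sq_letter l)%g.

Lemma gamma_sq_letterV l : gamma_sq_letter (inv_letter l) =
  (gamma_sq_letter l)^-1%g.
Proof. by case: l => s [] //=; rewrite /gamma_sq_letter /= invgK. Qed.

Lemma free_val_cat u v : free_val (u ++ v) = (free_val u * free_val v)%g.
Proof. by rewrite /free_val big_cat. Qed.

Lemma free_val_push l w : free_val (push l w) =
  (gamma_sq_letter l * free_val w)%g.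
Proof.
rewrite /free_val; case: w => [|m w]; first by rewrite big_cons.
rewrite /push; case: eqP => [->|_]; last by rewrite [LHS]big_cons.
by rewrite big_cons gamma_sq_letterV mulVKg.
Qed.

Notation point_act := (hurwitz_act (@point_op reduced_word)
  (@point_opV reduced_word)).

(** The sequence (push_1, ..., push_k, p, push_(k+1), ...): the point [p] sits
    at position [k]. *)
Definition point_at (k : nat) (p : reduced_word) :
    nat -> reduced_word + bijection reduced_word :=
  fun j => if (j < k)%N then inr (push_bij j.+1)
           else if j == k then inl p else inr (push_bij j).

Lemma sigma_point_at k p :
  point_act (sigma k.+1) (point_at k p) = point_at k.+1 p.
Proof.
rewrite /sigma (hurwitz_act_class (@point_rack _)); apply/funext => j.
rewrite /hurwitz /= /point_at.
have e1 : (k < k)%N = false by lia.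
have e2 : (k.+1 < k)%N = false by lia.
have e3 : (k.+1 == k) = false by lia.
case: (j =P k) => [->|jk]; first by rewrite !(e1,e2,e3,eqxx, leqnn).
case: (j =P k.+1) => [->|jk1]; first by rewrite !(e1,e2,e3,eqxx, leqnn, ltnn).
have [jlk|] := ltnP j k; first by rewrite ltnS (ltnW jlk).
by move=> kj; rewrite (_ : (j < k.+1)%N = false) //; lia.
Qed.

(** Here the point meets the bijection on its left, which acts on it. *)
Lemma sigma_point_at_succ k p :
  point_act (sigma k.+1) (point_at k.+1 p) = point_at k (rpush (k.+1, true) p).
Proof.
rewrite /sigma (hurwitz_act_class (@point_rack _)); apply/funext => j.
rewrite /hurwitz /= /point_at.
have e1 : (k < k)%N = false by lia.
have e2 : (k.+1 < k)%N = false by lia.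
have e3 : (k.+1 == k) = false by lia.
case: (j =P k) => [->|jk]; first by rewrite !(e1,e2,e3,eqxx, leqnn, ltnn).
case: (j =P k.+1) => [->|jk1]; first by rewrite !(e1,e2,e3,eqxx, leqnn, ltnn).
have [jlk|] := ltnP j k; first by rewrite ltnS (ltnW jlk).
by move=> kj; rewrite (_ : (j < k.+1)%N = false) //; lia.
Qed.

Lemma sigma_prod_point_at k p :
  point_act (sigma_prod 1 k.+1) (point_at 0 p) = point_at k p.
Proof.
elim: k => [|k IH]; first by rewrite /sigma_prod big_nil hurwitz_act1 //; exact:
  point_rack.
rewrite /sigma_prod big_nat_recr //= hurwitz_actM; last exact: point_rack.
by rewrite [X in point_act _ X]IH sigma_point_at.
Qed.

(** gamma_(k+1)^2 is the conjugate of sigma_(k+1)^2 by sigma_1 ... sigma_k: the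
    point moves to position k unchanged, turns around the bijection adding the
    letter k+1, and moves back unchanged. *)
Lemma gamma_sq_point_at k p :
  point_act (gamma k.+1 ^+ 2)%g (point_at 0 p) =
    point_at 0 (rpush (k.+1, true) p).
Proof.
have -> : (gamma k.+1 ^+ 2 = sigma_prod 1 k.+1 * sigma k.+1 * sigma k.+1
    * (sigma_prod 1 k.+1)^-1)%g.
  by rewrite expg2 /gamma -/(sigma_prod 1 k.+1) -!mulgA mulKg.
have HM := hurwitz_actM (@point_rack reduced_word).
rewrite !HM sigma_prod_point_at sigma_point_at sigma_point_at_succ.
by rewrite -[X in point_act _ X]sigma_prod_point_at -HM mulgV hurwitz_act1 //;
  exact: point_rack.
Qed.

Lemma gamma_sq_letter_point_at l p : (0 < l.1)%N ->
  point_act (gamma_sq_letter l) (point_at 0 p) = point_at 0 (rpush l p).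
Proof.
case: l => -[//|k] [] _; rewrite /gamma_sq_letter /=; first exact:
  gamma_sq_point_at.
rewrite -{1}[p](rpushVK (k.+1, true)) -gamma_sq_point_at.
by rewrite hurwitz_actK //; exact: point_rack.
Qed.

Lemma free_val_point_at w p : all (fun l => 0 < l.1)%N w ->
  point_act (free_val w) (point_at 0 p) =
  point_at 0 (foldl (fun q l => rpush l q) p w).
Proof.
elim: w p => [p _|l w IH p /= /andP[l0 w0]].
  by rewrite /free_val big_nil hurwitz_act1 //; exact: point_rack.
rewrite /free_val big_cons hurwitz_actM; last exact: point_rack.
by rewrite gamma_sq_letter_point_at // IH.
Qed.

Lemma foldl_rpush w : reduced w ->
  sval (foldl (fun q l => rpush l q) empty_word w) = rev w.
Proof.
elim/last_ind: w => //= w l IH wl; rewrite -cats1 foldl_cat /=.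
rewrite IH; last by move: wl; rewrite /reduced -cats1 => /cat_sorted2 [].
case/lastP: w wl {IH} => //= w m; rewrite rev_rcons cats1 !rev_rcons /push.
rewrite /reduced -!cats1 -catA => /cat_sorted2[_] /=; rewrite andbT.
by move=> lm; case: (m =P _) => [ml|//]; rewrite ml inv_letterK eqxx in lm.
Qed.

(** Starting from the empty word, a reduced word acts by writing itself down in
    reverse order. *)
Lemma free_val_inj u v : reduced u -> reduced v ->
  all (fun l => 0 < l.1)%N u -> all (fun l => 0 < l.1)%N v ->
  free_val u = free_val v -> u = v.
Proof.
move=> ru rv u0 v0 uv; apply: (can_inj revK); rewrite -!foldl_rpush //.
have := free_val_point_at empty_word u0; rewrite uv free_val_point_at //.
by move/(congr1 (fun s => s 0)); rewrite /point_at /= => -[->].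
Qed.

Definition free_on (S : set nat) : set braid :=
  gen_subgroup [set (gamma s ^+ 2)%g | s in S].

Lemma free_val_on (S : set nat) w :
  (forall l, l \in w -> S l.1) -> free_on S (free_val w).
Proof.
have SG : is_subgroup (free_on S) := gen_subgroup_subgroup _.
move=> Sw; rewrite /free_val big_seq; apply:
  (@subgroup_prod _ _ _ w (fun l => l \in w)) => // l /Sw Sl.
have Hl : free_on S (gamma l.1 ^+ 2)%g by apply: gen_subgroup_gen; exists l.1.
by rewrite /gamma_sq_letter; case: ifP => // _; exact: (subgroupV SG).
Qed.

Lemma free_on_reduced (S : set nat) x : free_on S x ->
  exists w, [/\ reduced w, forall l, l \in w -> S l.1 & x = free_val w].
Proof.
have mem_push l w m : m \in push l w -> m = l \/ m \in w.
  case: w => [|n w]; first by rewrite inE => /eqP; left.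
  rewrite /push; case: ifP => _; first by rewrite inE => ->; right;
    rewrite orbT.
  by rewrite inE => /orP[/eqP|]; [left|right].
have red w : (forall l, l \in w -> S l.1) -> exists w', [/\ reduced w',
    forall l, l \in w' -> S l.1 & free_val w = free_val w'].
  elim: w => [_|l w IH Sw]; first by exists [::].
  have [w0 [rw0 Sw0 ww0]] : exists w', [/\ reduced w',
      forall l, l \in w' -> S l.1 & free_val w = free_val w'].
    by apply: IH => m mw; apply: Sw; rewrite inE mw orbT.
  exists (push l w0); split; first exact: push_reduced.
    by move=> m /mem_push[->|/Sw0//]; apply: Sw; rewrite inE eqxx.
  by rewrite free_val_push -ww0 /free_val big_cons.
suff : free_on S `<=` [set x | exists2 w, forall l, l \in w ->
  S l.1 & x = free_val w].
  by move=> H /H[w /red[w' [rw' Sw' ww']] ->]; exists w'.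
apply: gen_subgroup_min.
  split; first by exists [::]; rewrite ?/free_val ?big_nil.
  move=> _ _ [u Su ->] [v Sv ->]; exists (u ++ map inv_letter (rev v)).
    move=> l; rewrite mem_cat => /orP[/Su//|/mapP[m]].
    by rewrite mem_rev => /Sv Sm ->.
  rewrite free_val_cat; congr (_ * _)%g.
  elim: v {Sv} => [|l v IH]; first by rewrite /free_val !big_nil invg1.
  rewrite rev_cons -cats1 map_cat free_val_cat -IH /free_val big_cons invgM.
  by rewrite big_seq1 gamma_sq_letterV.
move=> _ [s Ss <-]; exists [:: (s, true)]; first by move=> l;
  rewrite inE => /eqP ->.
by rewrite /free_val big_seq1.
Qed.

(** A common element has only one reduced word, which is over both alphabets. *)
Lemma free_on_cap (S T : set nat) x : S `<=` [set s | (0 < s)%N] ->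
  T `<=` [set s | (0 < s)%N] -> free_on S x -> free_on T x ->
    free_on (S `&` T) x.
Proof.
move=> S0 T0 /free_on_reduced[u [ru Su ->]] /free_on_reduced[v [rv Tv uv]].
have {}uv : u = v.
  by apply: free_val_inj => //; apply/allP => l; [move/Su/S0|move/Tv/T0].
by apply: free_val_on => l lu; split; [exact: Su|apply: Tv; rewrite -uv].
Qed.

(** Induction on the length, maintaining that the product is the value of a
    reduced word whose first letter outside [A] lies in the alphabet of the
    first factor.  Multiplying on the left by a factor over another alphabet,
    only the prefix over [A] can interact with it; the first letter outside [A]
    is not in the alphabet of the new factor and blocks further cancellation. *)
Lemma free_amalgam (I : eqType) (S : I -> set nat) (A : set nat)
    (n : nat) (i : nat -> I) (g : nat -> braid) :
  (forall j, S j `<=` [set s | (0 < s)%N]) -> (forall j, A `<=` S j) ->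
  (forall j k, j != k -> S j `&` S k `<=` A) ->
  (forall k, (k <= n)%N -> free_on (S (i k)) (g k) /\ ~ free_on A (g k)) ->
  (forall k, (k < n)%N -> i k != i k.+1) ->
  ~ free_on A (\prod_(k < n.+1) g k)%g.
Proof.
move=> S0 AS SA Hg Hi.
have AG : is_subgroup (free_on A) := gen_subgroup_subgroup _.
suff [w [rw w0 [a [l [w' [wE Aa Sl nAl]]]] gE]] : exists w : braid_word,
    [/\ reduced w, all (fun l => 0 < l.1)%N w, exists a l w',
      [/\ w = a ++ l :: w', forall l, l \in a -> A l.1, S (i 0) l.1 & ~ A l.1]
      & (\prod_(k < n.+1) g k)%g = free_val w].
  rewrite gE => /free_on_reduced[v [rv Av wv]].
  apply/nAl/Av; rewrite -(free_val_inj rw rv w0 _ wv) ?wE ?mem_cat ?inE ?eqxx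
    ?orbT //.
  by apply/allP => m /Av /(AS (i 0)) /(S0 (i 0)).
have split_word v (P : set nat) : (forall l, l \in v -> P l.1) ->
  ~ free_on A (free_val v) ->
    exists a l w', [/\ v = a ++ l :: w', forall l, l \in a ->
      A l.1, P l.1 & ~ A l.1].
  elim: v => [_ []|l v IH Pv nAv]; first by rewrite /free_val big_nil; exact:
    subgroup1.
  have [Al|nAl] := pselect (A l.1); last first.
    by exists [::], l, v; split=> //; apply: Pv; rewrite inE eqxx.
  have [|Av|a [m [w' [vE Aa Pm nAm]]]] := IH.
  - by move=> m mv; apply: Pv; rewrite inE mv orbT.
  - apply: nAv; rewrite -cat1s free_val_cat; apply: (subgroupM AG) => //.
    by apply: free_val_on => m; rewrite inE => /eqP ->.
  - exists (l :: a), m, w'; split=> //; first by rewrite vE.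
    by move=> k; rewrite inE => /orP[/eqP->//|/Aa].
elim: n i g Hg Hi => [|n IH] i g Hg Hi.
  have [/free_on_reduced[v [rv Sv gv]] nAg] := Hg 0 (leqnn _).
  exists v; split=> //; last by rewrite big_ord_recl big_ord0 mulg1.
    by apply/allP => l /Sv /S0.
  by apply: split_word => //; rewrite -gv.
have [w [rw w0 [a [l [w' [wE Aa Sl nAl]]]] gE]] := IH (i \o succn) (g \o succn)
  (fun k kn => Hg k.+1 kn) (fun k kn => Hi k.+1 kn).
have [/free_on_reduced[u [ru Su gu]] nAg] := Hg 0 (leq0n _).
(* absorb the prefix over A into the new factor and reduce *)
have [v [rv Sv uav]] : exists v, [/\ reduced v, forall l, l \in v -> S (i 0) l.1
    & (g 0 * free_val a)%g = free_val v].
  apply: free_on_reduced; rewrite gu -free_val_cat; apply: free_val_on => m.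
  by rewrite mem_cat => /orP[/Su|/Aa /AS].
have nAv : ~ free_on A (free_val v).
  rewrite -uav => Auv; apply: nAg; rewrite -[g 0](mulgK (free_val a)).
  by apply: (subgroupM AG) => //; apply: (subgroupV AG); exact: free_val_on.
have nSl : ~ S (i 0) l.1 by move=> S0l; apply: nAl; apply:
  (SA (i 0) (i 1)) => //; exact: Hi.
exists (v ++ l :: w'); split.
- rewrite /reduced.
  have := rw; rewrite /reduced wE => /cat_sorted2[_].
  case/lastP: v rv Sv {uav nAv} => // v m rv Sv; rewrite [sorted _ _]/= => lw'.
  rewrite cat_rcons /= in rv *.
  case: v rv Sv => [|n' v] rv Sv /=.
    rewrite lw' andbT; apply/eqP => lm; apply: nSl.
    by rewrite lm /=; apply: Sv; rewrite inE eqxx.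
  rewrite cat_path /=; move: rv;
    rewrite /reduced /= rcons_path => /andP[-> ->] /=.
  rewrite lw' andbT; apply/eqP => lm; apply: nSl.
  by rewrite lm /=; apply: Sv; rewrite mem_rcons inE eqxx.
- rewrite all_cat; apply/andP; split; first by apply/allP => m /Sv /S0.
  by move: w0; rewrite wE all_cat => /andP[].
- have [b [m [v' [vE Ab Sm nAm]]]] := split_word v _ Sv nAv.
  by exists b, m, (v' ++ l :: w'); split=> //; rewrite vE -catA.
- by rewrite big_ord_recl gE wE !free_val_cat mulgA uav.
Qed.

Import Order.TTheory GRing.Theory Num.Theory ComplexField.Normc.

Section VonNeumannAlgebras.
Local Open Scope ring_scope.

(** * Unordered sums *)

Section NonnegativeSums.
Variables (R : realType) (I : choiceType).
Implicit Types F H : I -> R.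

Definition psum F : \bar R := \esum_(x in [set: I]) (F x)%:E.

Lemma psum_ge0 F : (forall x, 0 <= F x) -> (0 <= psum F)%E.
Proof. by move=> F0; apply: esum_ge0 => x _; rewrite lee_fin. Qed.

Lemma psum_le F H : (forall x, F x <= H x) -> (psum F <= psum H)%E.
Proof. by move=> FH; apply: le_esum => x _; rewrite lee_fin. Qed.

Lemma psumD F H : (forall x, 0 <= F x) -> (forall x, 0 <= H x) ->
  psum (fun x => F x + H x) = (psum F + psum H)%E.
Proof.
move=> F0 H0; rewrite /psum -esumD; first by apply: eq_esum => x _;
  rewrite EFinD.
  by move=> x _; rewrite lee_fin.
by move=> x _; rewrite lee_fin.
Qed.

Lemma psum0 : psum (fun _ => 0) = 0%E.
Proof. exact: esum1. Qed.

End NonnegativeSums.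

Section NonnegativeSumsScaling.
Variables (R : realType) (G : groupType).
Implicit Types F H : G -> R.

Lemma psumZ (c : R) F : 0 <= c -> (forall x, 0 <= F x) ->
  psum (fun x => c * F x) = (c%:E * psum F)%E.
Proof.
move=> c0 F0; have Z (d : R) (H : G -> R) : 0 <= d -> (forall x, 0 <= H x) ->
    (psum (fun x => d * H x)%R <= d%:E * psum H)%E.
  move=> d0 H0; rewrite /psum.
  rewrite (eq_esum (b := fun x => (d%:E * (H x)%:E)%E)); last by move=> x _;
    rewrite EFinM.
  by apply: esumZl_le => // x; rewrite lee_fin.
have [->|cn0] := eqVneq c 0.
  by rewrite mul0e -[RHS](psum0 R G); congr psum; apply/funext => x;
    rewrite mul0r.
have {cn0} c1 : 0 < c by rewrite lt_neqAle eq_sym cn0.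
apply/eqP; rewrite eq_le Z //=.
rewrite (_ : psum F = psum (fun x => c^-1 * (c * F x))); last first.
  by congr psum; apply/funext => x; rewrite mulKf // gt_eqF.
apply: (@le_trans _ _ (c%:E * (c^-1%:E * psum (fun x => c * F x)%R))%E).
  rewrite lee_wpmul2l // ?lee_fin //; apply: Z; first by rewrite invr_ge0.
  by move=> x; rewrite mulr_ge0.
by rewrite muleA -EFinM divff ?mul1e // gt_eqF.
Qed.

End NonnegativeSumsScaling.

Section RealSums.
Variables (R : realType) (G : groupType).
Implicit Types h p n : G -> R.

Definition abs_summable h : Prop := (psum (fun x => `|h x|)%R < +oo)%E.

Lemma psum_fin_num p : (forall x, 0 <= p x) -> (psum p < +oo)%E ->
  psum p \is a fin_num.
Proof. by move=> p0 pf; rewrite ge0_fin_numE // psum_ge0. Qed.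

Lemma abs_summable_le h p : (forall x, `|h x| <= p x) -> (psum p < +oo)%E ->
  abs_summable h.
Proof. by move=> hp; apply: le_lt_trans; exact: psum_le. Qed.

(** The sum may be computed from any decomposition into nonnegative summable
    families, not only from the positive and negative parts; additivity follows
    from this freedom. *)
Lemma real_sum_sub p n : (forall x, 0 <= p x) -> (forall x, 0 <= n x) ->
  (psum p < +oo)%E -> (psum n < +oo)%E ->
  real_sum (fun x => p x - n x) = fine (psum p) - fine (psum n).
Proof.
move=> p0 n0 pf nf.
have sm (q : G -> R) : (forall x, 0 <= q x) -> (psum q < +oo)%E ->
    summable [set: G] (fun x => (q x)%:E).
  move=> q0 qf; rewrite /summable (eq_esum (b := fun x => (q x)%:E)) // => x _.
  by rewrite gee0_abs ?lee_fin.
have := esumB (sm _ p0 pf) (sm _ n0 nf).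
have p0' i : [set: G] i -> (0 <= (p i)%:E)%E by rewrite lee_fin.
have n0' i : [set: G] i -> (0 <= (n i)%:E)%E by rewrite lee_fin.
move=> /(_ p0' n0').
rewrite -/(psum p) -/(psum n) /real_sum.
rewrite (eq_esum (b := fun x => ((fun x => p x - n x)^\+ x)%:E)); last first.
  by move=> x _; rewrite funeposE /funrpos -EFinB EFin_max.
rewrite [X in (_ - X)%E](eq_esum (b :=
  fun x => ((fun x => p x - n x)^\- x)%:E)); last first.
  by move=> x _; rewrite funenegE /funrneg -EFinB -EFinN EFin_max.
have pn0 x : 0 <= (fun x => p x - n x)^\+
  x by rewrite /funrpos le_max lexx orbT.
have nn0 x : 0 <= (fun x => p x - n x)^\- x by rewrite /funrneg le_max lexx
  orbT.
have f1 : psum (fun x => p x - n x)^\+ \is a fin_num.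
  apply: psum_fin_num => //; apply: le_lt_trans pf; apply: psum_le => x.
  by rewrite /funrpos ge_max p0 andbT gerBl.
have f2 : psum (fun x => p x - n x)^\- \is a fin_num.
  apply: psum_fin_num => //; apply: le_lt_trans nf; apply: psum_le => x.
  by rewrite /funrneg ge_max n0 andbT opprB gerBl.
move=> /(congr1 fine); rewrite !fineB //; exact: psum_fin_num.
Qed.

Lemma pos_part_summable h : abs_summable h -> (psum h^\+%R < +oo)%E.
Proof.
apply: le_lt_trans; apply: psum_le => x.
by rewrite /funrpos ge_max ler_norm normr_ge0.
Qed.

Lemma neg_part_summable h : abs_summable h -> (psum h^\-%R < +oo)%E.
Proof.
apply: le_lt_trans; apply: psum_le => x.
by rewrite /funrneg ge_max -normrN ler_norm normr_ge0.
Qed.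

Lemma pos_part_ge0 h x : 0 <= h^\+ x.
Proof. by rewrite /funrpos le_max lexx orbT. Qed.

Lemma neg_part_ge0 h x : 0 <= h^\- x.
Proof. by rewrite /funrneg le_max lexx orbT. Qed.

Hint Resolve pos_part_ge0 neg_part_ge0 : core.

Lemma pos_neg_part h x : h^\+ x - h^\- x = h x.
Proof. by rewrite -[in RHS](funrposBneg h). Qed.

Lemma real_sumD h k : abs_summable h -> abs_summable k ->
  real_sum (fun x => h x + k x) = real_sum h + real_sum k.
Proof.
move=> hs ks.
have -> : (fun x => h x + k x) =
  (fun x => (h^\+ x + k^\+ x) - (h^\- x + k^\- x)).
  by apply/funext => x; rewrite -{1}(pos_neg_part h) -{1}(pos_neg_part k); ring.
have [h1 h2] := (pos_part_summable hs, neg_part_summable hs).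
have [k1 k2] := (pos_part_summable ks, neg_part_summable ks).
rewrite real_sum_sub; last 4 first.
- by move=> x; rewrite addr_ge0.
- by move=> x; rewrite addr_ge0.
- by rewrite psumD // lte_add_pinfty.
- by rewrite psumD // lte_add_pinfty.
rewrite !psumD // !fineD; try exact: psum_fin_num.
by rewrite /real_sum -!/(psum _); ring.
Qed.

Lemma real_sumN h : real_sum (fun x => - h x) = - real_sum h.
Proof.
rewrite /real_sum opprB; congr (fine (esum _ _) - fine (esum _ _)).
by apply/funext => x; rewrite /funrpos /funrneg opprK.
Qed.

Lemma real_sumZ c h : abs_summable h ->
  real_sum (fun x => c * h x) = c * real_sum h.
Proof.
move=> hs; have [h1 h2] := (pos_part_summable hs, neg_part_summable hs).
have Z (d : R) : 0 <= d -> real_sum (fun x => d * h x) = d * real_sum h.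
  move=> d0.
  have -> : (fun x => d * h x) = (fun x => d * h^\+ x - d * h^\- x).
    by apply/funext => x; rewrite -mulrBr pos_neg_part.
  rewrite real_sum_sub; last 4 first.
  - by move=> x; rewrite mulr_ge0.
  - by move=> x; rewrite mulr_ge0.
  - by rewrite psumZ // lte_mul_pinfty.
  - by rewrite psumZ // lte_mul_pinfty.
  rewrite !psumZ // !fineM //; try exact: psum_fin_num.
  by rewrite /real_sum -!/(psum _) mulrBr.
have [c0|/ltW c0] := leP 0 c; first exact: Z.
rewrite -[c]opprK mulNr -Z ?oppr_ge0 // -real_sumN; congr real_sum.
by apply/funext => x; rewrite mulNr.
Qed.

Lemma real_sum_ge0 p : (forall x, 0 <= p x) -> real_sum p = fine (psum p).
Proof.
move=> p0; rewrite /real_sum -!/(psum _).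
have -> : p^\- = fun _ => 0.
  by apply/funext => x; rewrite /funrneg; apply/max_idPr; rewrite oppr_le0.
by rewrite psum0 subr0; congr (fine (psum _)); apply/funext => x;
  apply/max_idPl.
Qed.

Lemma abs_summableD h k : abs_summable h -> abs_summable k ->
  abs_summable (fun x => h x + k x).
Proof.
move=> hs ks; apply: (@abs_summable_le _ (fun x => `|h x| + `|k x|)).
  by move=> x; exact: ler_normD.
by rewrite psumD // lte_add_pinfty.
Qed.

Lemma abs_summableZ c h : abs_summable h -> abs_summable (fun x => c * h x).
Proof.
move=> hs; apply: (@abs_summable_le _ (fun x => `|c| * `|h x|)).
  by move=> x; rewrite normrM.
by rewrite psumZ // lte_mul_pinfty.
Qed.

Lemma real_sum_linear c d h k l : abs_summable h -> abs_summable k ->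
  abs_summable l ->
  real_sum (fun x => (c * h x + d * k x) + l x) =
  (c * real_sum h + d * real_sum k) + real_sum l.
Proof.
move=> hs ks ls; have chs := abs_summableZ c hs; have dks := abs_summableZ d ks.
rewrite real_sumD //; last exact: abs_summableD.
by rewrite real_sumD // !real_sumZ.
Qed.

End RealSums.

Section ComplexSums.
Variables (R : realType) (G : groupType).
Local Notation C := R[i].
Implicit Types h k : G -> C.

Definition complex_summable h : Prop := (psum (fun x => normc (h x)) < +oo)%E.

Lemma normc_ge0 (z : C) : 0 <= normc z.
Proof. by case: z => a b; exact: sqrtr_ge0. Qed.

Lemma normc_sq (z : C) : normc z ^+ 2 = complex.Re z ^+ 2 + complex.Im z ^+ 2.
Proof. by case: z => a b; rewrite sqr_sqrtr // addr_ge0 // sqr_ge0. Qed.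

Lemma Re_le_normc (z : C) : `|complex.Re z| <= normc z.
Proof.
rewrite -(ler_pXn2r (n := 2)) ?nnegrE ?normc_ge0 // normc_sq real_normK
  ?num_real //.
by rewrite lerDl sqr_ge0.
Qed.

Lemma Im_le_normc (z : C) : `|complex.Im z| <= normc z.
Proof.
rewrite -(ler_pXn2r (n := 2)) ?nnegrE ?normc_ge0 // normc_sq real_normK
  ?num_real //.
by rewrite lerDr sqr_ge0.
Qed.

Lemma normc_conj (z : C) : normc z^*%C = normc z.
Proof. by case: z => a b /=; rewrite sqrrN. Qed.

Lemma Re_summable h : complex_summable h ->
  abs_summable (fun x => complex.Re (h x)).
Proof. by apply: abs_summable_le => x; exact: Re_le_normc. Qed.

Lemma Im_summable h : complex_summable h ->
  abs_summable (fun x => complex.Im (h x)).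
Proof. by apply: abs_summable_le => x; exact: Im_le_normc. Qed.

Lemma complex_sum_linear (a : C) h k : complex_summable h ->
  complex_summable k ->
  complex_sum (fun x => a * h x + k x) = a * complex_sum h + complex_sum k.
Proof.
move=> hs ks; have [hr hi] := (Re_summable hs, Im_summable hs).
have [kr ki] := (Re_summable ks, Im_summable ks).
rewrite /complex_sum.
have -> : (fun x => complex.Re (a * h x + k x)) =
   (fun x => (complex.Re a * complex.Re (h x) +
     (- complex.Im a) * complex.Im (h x)) + complex.Re (k x)).
  by apply/funext => x; case: a (h x) (k x) => [? ?] [? ?] [? ?] /=; ring.
have -> : (fun x => complex.Im (a * h x + k x)) =
   (fun x => (complex.Re a * complex.Im (h x) + complex.Im a * complex.Re (h x))
     + complex.Im (k x)).
  by apply/funext => x; case: a (h x) (k x) => [? ?] [? ?] [? ?] /=; ring.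
rewrite (real_sum_linear _ _ hr hi kr) (real_sum_linear _ _ hi hr ki).
case: a => a b; apply/eqP; rewrite eq_complex /=; apply/andP; split; apply/eqP;
  ring.
Qed.

Lemma complex_sum_conj h :
  complex_sum (fun x => (h x)^*%C) = (complex_sum h)^*%C.
Proof.
rewrite /complex_sum /=; congr Complex; first by congr real_sum;
  apply/funext => x; case: (h x).
by rewrite -real_sumN; congr real_sum; apply/funext => x; case: (h x).
Qed.

End ComplexSums.

Local Arguments normc : simpl never.

(** * The space of square-summable functions *)

Section Ell2Space.
Variables (R : realType) (G : groupType).
Local Notation C := R[i].
Local Notation ell2 := (ell2 R G).
Implicit Types f g h : ell2.

Lemma ell2_ext f g : (forall x, f x = g x) -> f = g.
Proof. by move=> fg; apply: val_inj; apply/funext. Qed.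

Lemma ell2E (a : C) f g x : (a *: f + g) x = a * f x + g x.
Proof. by []. Qed.

Lemma ell2_addE f g x : (f + g) x = f x + g x. Proof. by []. Qed.

Definition sqnorm f : R := fine (ell2_mass f).

Lemma sq_ge0 f x : 0 <= normc (f x) ^+ 2.
Proof. by rewrite sqr_ge0. Qed.

Lemma massE f : ell2_mass f = psum (fun x => normc (f x) ^+ 2).
Proof. by []. Qed.

Lemma mass_lty f : (ell2_mass f < +oo)%E.
Proof. by have /asboolP := ell2_valP f. Qed.

Lemma mass_ge0 f : (0 <= ell2_mass f)%E.
Proof. by rewrite massE; apply: psum_ge0 => x; exact: sq_ge0. Qed.

Lemma sqnormE f : ell2_mass f = (sqnorm f)%:E.
Proof. by rewrite /sqnorm fineK // ge0_fin_numE ?mass_ge0 // mass_lty. Qed.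

Lemma sqnorm_ge0 f : 0 <= sqnorm f.
Proof. by rewrite -lee_fin -sqnormE mass_ge0. Qed.

Lemma point_le_sqnorm f x : normc (f x) ^+ 2 <= sqnorm f.
Proof.
rewrite -lee_fin -sqnormE massE; apply: esum_ge; exists [set x].
  by split=> //; exact: finite_set1.
by rewrite fsbig_set1.
Qed.

Lemma restr_subproof (A : set G) f :
  (fun x => if x \in A then f x else 0) \in @square_summable R G.
Proof.
apply/asboolP; apply: le_lt_trans (mass_lty f); apply: psum_le => x.
by case: ifP => // _; rewrite normc0 expr0n sq_ge0.
Qed.

Definition restr (A : set G) f : ell2 := Ell2 (restr_subproof A f).

Lemma restrE A f x : restr A f x = if x \in A then f x else 0.
Proof. by []. Qed.

Lemma restr_restr A B f : restr A (restr B f) = restr (A `&` B) f.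
Proof.
apply: ell2_ext => x; rewrite !restrE in_setI.
by case: (x \in A); case: (x \in B).
Qed.

Lemma restr_lin A (a : C) f g :
  restr A (a *: f + g) = a *: restr A f + restr A g.
Proof.
apply: ell2_ext => x; rewrite ell2E !restrE ell2E.
by case: ifP => // _; rewrite mulr0 addr0.
Qed.

Lemma restr_delta A (y : G) :
  restr A (ell2_delta R y) = if y \in A then ell2_delta R y else 0.
Proof.
apply: ell2_ext => x; rewrite restrE /=.
have [->|xy] := eqVneq x y; first by case: (y \in A); rewrite //= eqxx.
by case: (x \in A); case: (y \in A); rewrite //= (negbTE xy).
Qed.

Lemma restr_split A f : f = restr A f + restr (~` A) f.
Proof.
apply: ell2_ext => x; rewrite ell2_addE !restrE in_setC.
by case: (x \in A); rewrite ?addr0 ?add0r.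
Qed.

Lemma restr_sqnorm_le A f : sqnorm (restr A f) <= sqnorm f.
Proof.
rewrite -lee_fin -!sqnormE !massE; apply: psum_le => x; rewrite restrE.
by case: ifP => // _; rewrite normc0 expr0n sq_ge0.
Qed.

Lemma finite_approx f (e : R) : 0 < e ->
  exists s : seq G, sqnorm (restr (~` [set` s]) f) < e.
Proof.
move=> e0; have : ((sqnorm f - e)%:E < ell2_mass f)%E.
  by rewrite sqnormE lte_fin gtrBl.
move=> /ereal_sup_gt[_ [A [Afin _] <-]] fA.
have /finite_seqP[s As] := Afin; exists s; rewrite -As.
move: fA; rewrite -esum_fset //; last by move=> x _; rewrite lee_fin sq_ge0.
move=> fA.
have AE : (\esum_(x in A) (normc (f x) ^+ 2)%:E = (sqnorm (restr A f))%:E)%E.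
  rewrite -sqnormE massE esum_mkcond; apply: eq_esum => x _.
  by rewrite restrE; case: ifP => // _; rewrite normc0 expr0n.
move: fA; rewrite AE lte_fin => fA.
have : sqnorm f = sqnorm (restr A f) + sqnorm (restr (~` A) f).
  apply: EFin_inj; rewrite EFinD -!sqnormE !massE -psumD; last 2 first.
  - by move=> x; exact: sq_ge0.
  - by move=> x; exact: sq_ge0.
  congr psum; apply/funext => x; rewrite !restrE in_setC.
  by case: (x \in A) => /=; rewrite normc0 expr0n ?addr0 ?add0r.
by lra.
Qed.

Definition linear_fun (V : lmodType C) (phi : ell2 -> V) : Prop :=
  forall (a : C) f g, phi (a *: f + g) = a *: phi f + phi g.

Lemma linear_fun0 (V : lmodType C) (phi : ell2 -> V) : linear_fun phi ->
  phi 0 = 0.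
Proof.
move=> /(_ (-1) 0 0); rewrite scaler0 addr0 scaleN1r => /eqP.
by rewrite addrC subrr => /eqP.
Qed.

(** The functional vanishes on finitely supported functions, and these
    approximate every [f] in norm. *)
Lemma functional_density (phi : ell2 -> C^o) (c : R) : linear_fun phi ->
  0 <= c ->
  (forall f, normc (phi f) ^+ 2 <= c * sqnorm f) ->
  (forall y, phi (ell2_delta R y) = 0) -> forall f, phi f = 0.
Proof.
move=> phil c0 phic phid f.
have phis (s : seq G) : phi (restr [set` s] f) = 0.
  elim: s => [|y s IH].
    rewrite (_ : restr _ f = 0) ?linear_fun0 //; apply: ell2_ext => x.
    by rewrite restrE; case: ifP => //; rewrite inE.
  have [ys|ys] := boolP (y \in s).
    rewrite (_ : [set` y :: s] = [set` s]) //; apply/seteqP; split=> x /=;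
      rewrite inE.
      by move=> /orP[/eqP->|].
    by move=> ->; rewrite orbT.
  rewrite (_ : restr _ f = f y *: ell2_delta R y + restr [set` s] f).
    by rewrite phil IH phid scaler0 addr0.
  apply: ell2_ext => x; rewrite ell2E !restrE /= !mem_setE inE.
  have [->|xy] := eqVneq x y; first by rewrite (negbTE ys) mulr1 addr0.
  by rewrite mulr0 add0r.
apply: eq0_normc; apply/eqP; rewrite -sqrf_eq0 eq_le sqr_ge0 andbT.
apply/ler_addgt0Pl => e e0; rewrite addr0.
have e1 : 0 < e / (c + 1) by rewrite divr_gt0 // ltr_wpDl.
have [s fs] := finite_approx f e1.
rewrite (restr_split [set` s] f) -[restr [set` s] f]scale1r phil phis.
rewrite scaler0 add0r (le_trans (phic _)) //.
have c1 : 0 < c + 1 by rewrite ltr_wpDl.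
apply: (@le_trans _ _ ((c + 1) * (e / (c + 1)))).
  by apply: ler_pM => //; [exact: sqnorm_ge0|rewrite lerDl|exact: ltW].
by rewrite mulrCA divff ?mulr1 // gt_eqF.
Qed.

Lemma dot_summable f g : complex_summable (fun x => f x * (g x)^*%C).
Proof.
rewrite /complex_summable.
apply: (@le_lt_trans _ _ (psum (fun x => normc (f x) ^+ 2 + normc (g x) ^+ 2))).
  apply: psum_le => x; rewrite normcM normc_conj.
  have := sqr_ge0 (normc (f x) - normc (g x)).
  have := mulr_ge0 (normc_ge0 (f x)) (normc_ge0 (g x)).
  rewrite sqrrB; set u := normc (f x); set v := normc (g x);
    rewrite !expr2 => ? ?.
  by lra.
rewrite psumD; [|by move=> x; exact: sq_ge0|by move=> x; exact: sq_ge0].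
by rewrite lte_add_pinfty // mass_lty.
Qed.

Lemma dot_linl (a : C) f g h :
  ell2_dot (a *: f + g) h = a * ell2_dot f h + ell2_dot g h.
Proof.
rewrite /ell2_dot -complex_sum_linear;
  [|exact: dot_summable|exact: dot_summable].
by congr complex_sum; apply/funext => x; rewrite ell2E mulrDl mulrA.
Qed.

Lemma dot_conj f g : ell2_dot g f = (ell2_dot f g)^*%C.
Proof.
rewrite /ell2_dot -complex_sum_conj; congr complex_sum; apply/funext => x.
by rewrite rmorphM /= conjcK mulrC.
Qed.

Lemma dot_linr (a : C) f g h :
  ell2_dot f (a *: g + h) = a^*%C * ell2_dot f g + ell2_dot f h.
Proof.
by rewrite (dot_conj (a *: g + h) f) dot_linl (dot_conj g f) (dot_conj h f)
  rmorphD rmorphM.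
Qed.

Lemma dot_self f : ell2_dot f f = (sqnorm f)%:C%C.
Proof.
have E x : f x * (f x)^*%C = (normc (f x) ^+ 2)%:C%C.
  case: (f x) => a b; rewrite normc_sq /=.
  by apply/eqP; rewrite eq_complex /=; apply/andP; split; apply/eqP; ring.
rewrite /ell2_dot /complex_sum; congr Complex.
  rewrite (_ : (fun x => _) = (fun x => normc (f x) ^+ 2)).
    by rewrite real_sum_ge0 // => x; exact: sq_ge0.
  by apply/funext => x; rewrite E.
rewrite (_ : (fun x => _) = (fun x => 0)).
  by rewrite real_sum_ge0 // psum0.
by apply/funext => x; rewrite E.
Qed.

Lemma dot0l g : ell2_dot 0 g = 0.
Proof.
have := dot_linl (-1) 0 0 g; rewrite scaler0 addr0 mulN1r => /eqP.
by rewrite addrC subrr => /eqP.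
Qed.

Lemma dot0r f : ell2_dot f 0 = 0.
Proof. by rewrite dot_conj dot0l conjc0. Qed.

Lemma sqnorm_eq0 f : sqnorm f = 0 -> f = 0.
Proof.
move=> f0; apply: ell2_ext => x; apply: eq0_normc; apply/eqP.
by rewrite -sqrf_eq0 eq_le sqr_ge0 andbT -f0 point_le_sqnorm.
Qed.

(** The square norm of |g|^2 f - <f, g> g is nonnegative. *)
Lemma cauchy_schwarz f g : normc (ell2_dot f g) ^+ 2 <= sqnorm f * sqnorm g.
Proof.
have [g0|g0] := eqVneq (sqnorm g) 0.
  by rewrite (sqnorm_eq0 g0) dot_conj dot0l conjc0 normc0 expr0n mulr_ge0 //
    sqnorm_ge0.
have {}g0 : 0 < sqnorm g by rewrite lt_neqAle eq_sym g0 sqnorm_ge0.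
set d := ell2_dot f g; set n := sqnorm g in g0 *; set m := sqnorm f.
have dd : d * d^*%C = (normc d ^+ 2)%:C%C.
  case: (d) => a b; rewrite normc_sq /=.
  by apply/eqP; rewrite eq_complex /=; apply/andP; split; apply/eqP; ring.
have := sqnorm_ge0 (n%:C%C *: f + (- d *: g + 0)).
have -> : sqnorm (n%:C%C *: f + (- d *: g + 0)) = n * (n * m - normc d ^+ 2).
  have cE : (n * (n * m - normc d ^+ 2))%:C%C =
      n%:C%C * (n%:C%C * m%:C%C - (normc d ^+ 2)%:C%C) by rewrite rmorphM
        rmorphB rmorphM.
  have cN : (- d)^*%C = - d^*%C by rewrite rmorphN.
  apply: complexI; rewrite cE -dd -dot_self !(dot_linl, dot_linr) !dot0l !dot0r.
  rewrite !dot_self -/n -/m (dot_conj f g) -/d cN conjc_real.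
  move: (d^*%C) => e; ring.
by rewrite pmulr_rge0 // subr_ge0 mulrC.
Qed.

Lemma dot_delta f y : ell2_dot f (ell2_delta R y) = f y.
Proof.
have P (F : C -> R) (p := fun x => F (f x * (ell2_delta R y x)^*%C)) :
  F 0 = 0 ->
    real_sum p = F (f y).
  move=> F0; have pE x : p x = if x == y then F (f y) else 0.
    rewrite /p /=; have [->|_] := eqVneq x y; first by rewrite conjc1 mulr1.
    by rewrite conjc0 mulr0.
  have S (q : G -> R) : (forall x, 0 <= q x) -> (forall x, x != y -> q x = 0) ->
      psum q = (q y)%:E.
    move=> q0 qy; rewrite -(@esum_set1 _ _ y (fun x => (q x)%:E)) ?lee_fin //.
    rewrite [RHS]esum_mkcond; apply: eq_esum => x _; case: ifP => //.
    move=> /negP; rewrite inE /= => /eqP xy; by rewrite qy.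
  rewrite /real_sum -!/(psum _) !S.
  - by rewrite /= pos_neg_part pE eqxx.
  - by move=> x; exact: neg_part_ge0.
  - by move=> x xy; rewrite /funrneg pE (negbTE xy) oppr0 maxxx.
  - by move=> x; exact: pos_part_ge0.
  - by move=> x xy; rewrite /funrpos pE (negbTE xy) maxxx.
rewrite /ell2_dot /complex_sum (P (@complex.Re R)) // (P (@complex.Im R)) //.
by case: (f y).
Qed.

End Ell2Space.

(** * Bounded operators and bounded functionals *)

Section Reindexing.
Variables (R : realType) (G : groupType).

Lemma psum_reindex (e : G -> G) (F : G -> R) : bijective e ->
  psum (F \o e) = psum F.
Proof.
move=> [e' eK e'K]; rewrite /psum [RHS](reindex_esum [set: G] _ e) //.
split=> [x //|x y _ _ /(congr1 e')|x _]; first by rewrite !eK.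
by exists (e' x) => //; exact: e'K.
Qed.

Lemma complex_sum_reindex (e : G -> G) (F : G -> R[i]) : bijective e ->
  complex_sum (F \o e) = complex_sum F.
Proof.
move=> be; have re (h : G -> R) : real_sum (h \o e) = real_sum h.
  rewrite /real_sum -!/(psum _) -(psum_reindex h^\+ be) -(psum_reindex h^\- be).
  by [].
by rewrite /complex_sum -(re (fun x => complex.Re (F x)))
  -(re (fun x => complex.Im (F x))).
Qed.

End Reindexing.

Section BoundedFunctionals.
Variables (R : realType) (G : groupType).
Local Notation C := R[i].
Local Notation ell2 := (ell2 R G).

Definition bounded_functional (phi : ell2 -> C) : Prop :=
  @linear_fun R G C^o phi /\
  exists2 c : R, 0 <= c & forall f, normc (phi f) ^+ 2 <= c * sqnorm f.

Lemma normc_sqD (u v : C) :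
  normc (u + v) ^+ 2 <= 2 * normc u ^+ 2 + 2 * normc v ^+ 2.
Proof.
apply: (@le_trans _ _ ((normc u + normc v) ^+ 2)).
  by rewrite ler_pXn2r ?nnegrE ?addr_ge0 ?normc_ge0 // le_normcD.
have := sqr_ge0 (normc u - normc v); rewrite sqrrB sqrrD.
by set a := normc u; set b := normc v; lra.
Qed.

Lemma bounded_functional_eq (phi psi : ell2 -> C) :
  bounded_functional phi -> bounded_functional psi ->
  (forall y, phi (ell2_delta R y) = psi (ell2_delta R y)) ->
  forall f, phi f = psi f.
Proof.
move=> [phil [c c0 phic]] [psil [d d0 psid]] e f; apply/eqP; rewrite -subr_eq0;
  apply/eqP.
apply: (@functional_density R G (fun f => phi f - psi f) (2 * c + 2 * d)).
- by move=> a g h; rewrite phil psil scalerBr opprD addrACA.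
- by rewrite addr_ge0 // mulr_ge0.
- move=> g; apply: (le_trans (normc_sqD _ _)); rewrite normcN.
  have -> : (2 * c + 2 * d) * sqnorm g = 2 * (c * sqnorm g) +
    2 * (d * sqnorm g) by ring.
  by have := phic g; have := psid g; lra.
- by move=> y; rewrite e subrr.
Qed.

Lemma bounded_functional_dot (h : ell2) :
  bounded_functional (fun f => ell2_dot f h).
Proof.
split; first by move=> a f g; rewrite dot_linl.
exists (sqnorm h); first exact: sqnorm_ge0.
by move=> f; rewrite mulrC; exact: cauchy_schwarz.
Qed.

End BoundedFunctionals.

Section Operators.
Variables (R : realType) (G : groupType).
Local Notation C := R[i].
Local Notation ell2 := (ell2 R G).
Local Notation op := (ell2 -> ell2).
Local Notation delta := (ell2_delta R).
Implicit Types (T U X : op) (f : ell2).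

Lemma bounded_opP T : bounded_op T <->
  linear_fun T /\
  exists2 c : R, 0 <= c & forall f, sqnorm (T f) <= c * sqnorm f.
Proof.
have sq f : ell2_norm f ^+ 2 = sqnorm f by rewrite sqr_sqrtr // sqnorm_ge0.
have n0 f : 0 <= ell2_norm f by exact: sqrtr_ge0.
split=> -[Tl [c]]; last first.
  move=> c0 Tc; split=> //; exists (Num.sqrt c) => f.
  by rewrite /ell2_norm -sqrtrM // ler_sqrt ?mulr_ge0 ?sqnorm_ge0 //; exact: Tc.
move=> Tc; split=> //; exists (c ^+ 2); first exact: sqr_ge0.
move=> f; rewrite -!sq -exprMn ler_pXn2r ?nnegrE // (le_trans _ (Tc f)) //.
Qed.

Lemma bounded_linear T : bounded_op T -> linear_fun T.
Proof. by case. Qed.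

Lemma bounded_op0 T : bounded_op T -> T 0 = 0.
Proof. by move=> /bounded_linear /linear_fun0. Qed.

Lemma bounded_functional_eval T x : bounded_op T ->
  bounded_functional (fun f => T f x).
Proof.
move=> /bounded_opP[Tl [c c0 Tc]]; split; first by move=> a f g; rewrite Tl.
by exists c => // f; apply: le_trans (Tc f); exact: point_le_sqnorm.
Qed.

Lemma bounded_op_eq T U : bounded_op T -> bounded_op U ->
  (forall y, T (delta y) = U (delta y)) -> T = U.
Proof.
move=> Tb Ub TU; apply/funext => f; apply: ell2_ext => x.
apply: (@bounded_functional_eq R G (fun f => T f x) (fun f => U f x));
  [exact: bounded_functional_eval|exact: bounded_functional_eval|].
by move=> y; rewrite TU.
Qed.

Lemma bounded_comp T U : bounded_op T -> bounded_op U -> bounded_op (T \o U).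
Proof.
move=> /bounded_opP[Tl [c c0 Tc]] /bounded_opP[Ul [d d0 Ud]]; apply/bounded_opP.
split; first by move=> a f g /=; rewrite Ul Tl.
exists (c * d); first by rewrite mulr_ge0.
move=> f /=; apply: (le_trans (Tc _)); rewrite -mulrA.
by rewrite ler_wpM2l.
Qed.

Lemma bounded_lin (a : C) T U : bounded_op T -> bounded_op U ->
  bounded_op (a *: T + U).
Proof.
move=> /bounded_opP[Tl [c c0 Tc]] /bounded_opP[Ul [d d0 Ud]]; apply/bounded_opP.
have lE f : (a *: T + U) f = a *: T f + U f by [].
split.
  move=> b f g; rewrite !lE Tl Ul !scalerDr addrACA; congr (_ + _).
  by congr (_ + _); rewrite !scalerA mulrC.
have A0 : 0 <= 2 * normc a ^+ 2 by apply: mulr_ge0; rewrite ?sqr_ge0.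
exists (2 * normc a ^+ 2 * c + 2 * d).
  by apply: addr_ge0; apply: mulr_ge0.
move=> f; rewrite lE.
apply: (@le_trans _ _ (2 * normc a ^+ 2 * sqnorm (T f) + 2 * sqnorm (U f))).
  have S0 (h : ell2) x : 0 <= normc (h x) ^+ 2 by rewrite sqr_ge0.
  have -> : 2 * normc a ^+ 2 * sqnorm (T f) + 2 * sqnorm (U f) =
      fine (psum (fun x => 2 * normc a ^+ 2 * normc (T f x) ^+ 2 +
        2 * normc (U f x) ^+ 2)).
    rewrite psumD; [|by move=> x; rewrite mulr_ge0|by move=> x;
      rewrite mulr_ge0].
    by rewrite !psumZ // -!massE !sqnormE -!EFinM -EFinD.
  rewrite -lee_fin -sqnormE massE fineK; last first.
    apply: psum_fin_num => [x|]; first by rewrite addr_ge0 // mulr_ge0.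
    rewrite psumD; [|by move=> x; rewrite mulr_ge0|by move=> x;
      rewrite mulr_ge0].
    by rewrite !psumZ // -!massE !sqnormE -!EFinM -EFinD ltry.
  apply: psum_le => x; rewrite ell2E; apply: (le_trans (normc_sqD _ _)).
  by rewrite normcM exprMn mulrA.
have -> : (2 * normc a ^+ 2 * c + 2 * d) * sqnorm f =
  2 * normc a ^+ 2 * (c * sqnorm f) + 2 * (d * sqnorm f) by ring.
by apply: lerD; apply: ler_wpM2l.
Qed.

Lemma bounded_id : bounded_op (idfun : op).
Proof.
by apply/bounded_opP; split=> //; exists 1 => // f; rewrite mul1r.
Qed.

Lemma bounded_restr (A : set G) : bounded_op (@restr R G A).
Proof.
apply/bounded_opP; split; first by move=> a f g; rewrite restr_lin.
by exists 1 => // f; rewrite mul1r; exact: restr_sqnorm_le.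
Qed.

Lemma reindex_subproof (e : G -> G) f : bijective e ->
  (fun x => f (e x)) \in @square_summable R G.
Proof.
move=> be; apply/asboolP; apply: le_lt_trans (mass_lty f).
by rewrite massE -(psum_reindex (fun x => normc (f x) ^+ 2) be).
Qed.

Lemma mulr_bij (g : G) : bijective (fun x => x * g)%g.
Proof. by exists (fun x => x * g^-1)%g => x; rewrite ?mulgK ?mulgVK. Qed.

Lemma mull_bij (g : G) : bijective (fun x => g * x)%g.
Proof. by exists (fun x => g^-1 * x)%g => x; rewrite ?mulKg ?mulVKg. Qed.

Definition rregular (g : G) f : ell2 := Ell2 (reindex_subproof f (mulr_bij g)).

Lemma rregularE g f x : rregular g f x = f (x * g)%g. Proof. by []. Qed.

Lemma sqnorm_reindex (e : G -> G) f (h : ell2) : bijective e ->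
  (forall x, h x = f (e x)) ->
  sqnorm h = sqnorm f.
Proof.
move=> be fh; apply: EFin_inj; rewrite -!sqnormE !massE.
rewrite -(psum_reindex (fun x => normc (f x) ^+ 2) be).
by congr psum; apply/funext => x; rewrite fh.
Qed.

Lemma bounded_rregular g : bounded_op (rregular g).
Proof.
apply/bounded_opP; split; first by move=> a f h; apply: ell2_ext => x.
by exists 1 => // f; rewrite mul1r (@sqnorm_reindex _ f _ (mulr_bij g)).
Qed.

Lemma bounded_lregular s : bounded_op (lregular R (s : G)).
Proof.
apply/bounded_opP; split; first by move=> a f h; apply: ell2_ext => x.
by exists 1 => // f; rewrite mul1r (@sqnorm_reindex _ f _ (mull_bij s^-1%g)).
Qed.

Lemma rregular_delta g y : rregular g (delta y) = delta (y * g^-1)%g.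
Proof.
apply: ell2_ext => x; rewrite rregularE /=; congr (_%:R); congr nat_of_bool.
by apply/eqP/eqP => [<-|->]; rewrite ?mulgK ?mulgVK.
Qed.

Lemma lregular_delta (s y : G) : lregular R s (delta y) = delta (s * y)%g.
Proof.
apply: ell2_ext => x /=; congr (_%:R); congr nat_of_bool.
by apply/eqP/eqP => [<-|->]; rewrite ?mulKg ?mulVKg.
Qed.

Lemma rregular_adjoint g : is_adjoint (rregular g) (rregular g^-1%g).
Proof.
move=> f h; rewrite /ell2_dot -[RHS](complex_sum_reindex _ (mulr_bij g)).
by congr complex_sum; apply/funext => x; rewrite /= mulgK.
Qed.

Lemma lregular_adjoint (s : G) : is_adjoint (lregular R s) (lregular R s^-1%g).
Proof.
move=> f h; rewrite /ell2_dot -[LHS](complex_sum_reindex _ (mull_bij s)).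
by congr complex_sum; apply/funext => x; rewrite /= mulKg invgK.
Qed.

Lemma lregularM (s t : G) : lregular R s \o lregular R t = lregular R (s * t)%g.
Proof. by apply/funext => f; apply: ell2_ext => x /=; rewrite invgM mulgA. Qed.

Lemma lregular1 : lregular R (1 : G)%g = idfun.
Proof. by apply/funext => f; apply: ell2_ext => x /=; rewrite invg1 mul1g. Qed.

Lemma adjointE T U g x : is_adjoint T U -> U g x = ell2_dot g (T (delta x)).
Proof. by move=> TU; rewrite dot_conj TU -dot_conj dot_delta. Qed.

(** |U g|^2 = <T U g, g> is at most |T U g| |g|, which is bounded by a multiple
    of |U g| |g|. *)
Lemma bounded_adjoint T U : bounded_op T -> is_adjoint T U -> bounded_op U.
Proof.
move=> /bounded_opP[Tl [c c0 Tc]] TU; apply/bounded_opP; split.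
  by move=> a f g; apply: ell2_ext => x;
    rewrite ell2E !(adjointE _ _ TU) dot_linl.
exists c => // g; have [->|Ug0] := eqVneq (sqnorm (U g)) 0.
  by rewrite mulr_ge0 ?sqnorm_ge0.
have {}Ug0 : 0 < sqnorm (U g) by rewrite lt_neqAle eq_sym Ug0 sqnorm_ge0.
have := cauchy_schwarz (T (U g)) g; rewrite TU dot_self.
have -> : normc (sqnorm (U g))%:C%C ^+ 2 = sqnorm (U g) * sqnorm (U g).
  by rewrite normc_sq /= expr0n addr0 expr2.
have := ler_wpM2r (sqnorm_ge0 g) (Tc (U g)).
by move=> /[swap] /le_trans h /h; rewrite mulrAC ler_pM2r.
Qed.

End Operators.

(** * The von Neumann algebra of a subgroup *)

Section GroupVonNeumannAlgebra.
Variables (R : realType) (G : groupType).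
Local Notation C := R[i].
Local Notation ell2 := (ell2 R G).
Local Notation op := (ell2 -> ell2).
Local Notation delta := (@ell2_delta R G).
Implicit Types (T U X : op) (f : ell2) (H : set G).

(** These operators turn out to be the left convolutions by square-summable
    functions supported on [H]; the support condition is put on the value at
    delta_1, which determines the operator. *)
Definition convolvers H : set op := [set T |
  [/\ bounded_op T, forall g, T \o rregular g = rregular g \o T
    & forall x, ~ H x -> T (delta 1%g) x = 0]].

Definition right_coset H (x : G) : set G := [set y | H (y * x^-1)%g].

Lemma right_coset_mem H x y z : is_subgroup H -> right_coset H x y ->
  H (z * y^-1)%g -> right_coset H x z.
Proof.
move=> HG xy zy; rewrite /right_coset /=.
have -> : (z * x^-1 = (z * y^-1) * (y * x^-1))%g by rewrite mulgA mulgVK.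
exact: (subgroupM HG).
Qed.

Lemma right_coset_sym H x y : is_subgroup H -> right_coset H x y ->
  right_coset H y x.
Proof.
by move=> HG /(subgroupV HG); rewrite /right_coset /= invgM invgK.
Qed.

Lemma right_coset_refl H x : is_subgroup H -> right_coset H x x.
Proof. by move=> HG; rewrite /right_coset /= mulgV; exact: subgroup1. Qed.

Lemma convolver_delta T y x : (forall g, T \o rregular g = rregular g \o T) ->
  T (delta y) x = T (delta 1%g) (x * y^-1)%g.
Proof.
move=> TR; rewrite -rregularE -[RHS]/((rregular y^-1%g \o T) (delta 1%g) x) -TR.
by rewrite /= rregular_delta invgK mul1g.
Qed.

(** A left convolution by a function on H maps functions supported on a right
    coset H x to such functions. *)
Lemma convolver_restr H T x : is_subgroup H -> convolvers H T ->
  T \o restr (right_coset H x) = restr (right_coset H x) \o T.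
Proof.
move=> HG [Tb TR Ts]; apply: bounded_op_eq.
- by apply: bounded_comp => //; exact: bounded_restr.
- by apply: bounded_comp => //; exact: bounded_restr.
move=> y; rewrite /comp; apply: ell2_ext => z; rewrite restrE restr_delta.
have [yx|yx] := pselect (right_coset H x y).
  rewrite mem_set //; have [zx|zx] := pselect (right_coset H x z).
    by rewrite mem_set.
  rewrite memNset // convolver_delta // Ts // => zy.
  by apply: zx; exact: (right_coset_mem HG yx).
rewrite memNset // (bounded_op0 Tb); case: ifP => //; rewrite inE => zx.
rewrite convolver_delta // Ts // => zy; apply: yx.
apply: (right_coset_mem HG zx); exact: (right_coset_sym (x := y) (y := z) HG).
Qed.

Lemma mulVl_bij (x : G) : bijective (fun h => h^-1 * x)%g.
Proof.
exists (fun h => x * h^-1)%g => h; rewrite invgM invgK.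
  by rewrite mulgA mulgV mul1g.
by rewrite -mulgA mulVg mulg1.
Qed.

Lemma flip_subproof (x : G) f :
  (fun h => (f (h^-1 * x)%g)^*%C) \in @square_summable R G.
Proof.
apply/asboolP; apply: le_lt_trans (mass_lty f).
have be := mulVl_bij x.
rewrite massE -(psum_reindex (fun h => normc (f h) ^+ 2) be) /ell2_mass
  -/(psum _).
by apply: psum_le => h; rewrite normc_conj.
Qed.

(** Designed so that the inner product of xi with it is the value at x of the
    convolution of xi and f. *)
Definition flip (x : G) f : ell2 := Ell2 (flip_subproof x f).

Lemma flipE x f h : flip x f h = (f (h^-1 * x)%g)^*%C. Proof. by []. Qed.

Lemma flip_delta x y : flip x (delta y) = delta (x * y^-1)%g.
Proof.
apply: ell2_ext => h; rewrite flipE /= conjc_nat; congr (_%:R);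
  congr nat_of_bool.
by apply/eqP/eqP => [<-|->]; rewrite invgM invgK ?mulgA ?mulgV ?mul1g // -mulgA
  mulVg mulg1.
Qed.

Lemma sqnorm_flip x f : sqnorm (flip x f) <= sqnorm f.
Proof.
have be := mulVl_bij x.
rewrite -lee_fin -!sqnormE !massE
  -(psum_reindex (fun h => normc (f h) ^+ 2) be).
by apply: psum_le => h; rewrite flipE normc_conj.
Qed.

Lemma bounded_functional_flip x (h : ell2) :
  bounded_functional (fun f => ell2_dot h (flip x f)).
Proof.
split.
  move=> a f g; have -> : flip x (a *: f + g) = a^*%C *: flip x f + flip x g.
    by apply: ell2_ext => y; rewrite ell2E !flipE ell2E rmorphD rmorphM.
  by rewrite dot_linr conjcK.
exists (sqnorm h); first exact: sqnorm_ge0.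
move=> f; apply: (le_trans (cauchy_schwarz _ _)).
by rewrite ler_wpM2l ?sqnorm_ge0 // sqnorm_flip.
Qed.

Lemma convolverE T f x : bounded_op T ->
  (forall g, T \o rregular g = rregular g \o T) ->
  T f x = ell2_dot (T (delta 1%g)) (flip x f).
Proof.
move=> Tb TR; move: f.
apply: (@bounded_functional_eq R G (fun f => T f x)).
- exact: bounded_functional_eval.
- exact: bounded_functional_flip.
by move=> y; rewrite flip_delta dot_delta convolver_delta.
Qed.

(** Write xi for the symbol of [T] and eta for X delta_g.  Since [X] commutes
    with the L_h, both X T delta_g and T X delta_g are the convolution of xi and
    eta: the first by density in xi, the second by density in eta. *)
Lemma convolver_commutant H T X : convolvers H T ->
  commutant (lregular R @` H) X -> X \o T = T \o X.
Proof.
move=> [Tb TR Ts] [Xb XL]; apply: bounded_op_eq; [exact: bounded_comp..|].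
move=> g; apply: ell2_ext => x /=; rewrite (convolverE _ _ Tb TR).
have -> : T (delta g) = rregular g^-1%g (T (delta 1%g)).
  by rewrite -[RHS]/((rregular g^-1%g \o T) (delta 1%g)) -TR /=
    rregular_delta invgK mul1g.
have Hr : T (delta 1%g) = restr H (T (delta 1%g)).
  apply: ell2_ext => y; rewrite restrE; case: ifPn => // yH; apply: Ts => Hy.
  by rewrite mem_set in yH.
rewrite Hr; move: (T (delta 1%g)) => f {Tb TR Ts Hr T}; move: f.
have bf phi : bounded_functional phi ->
  bounded_functional (phi \o @restr R G H).
  move=> [phil [c c0 phic]]; split; first by move=> a f h /=;
    rewrite restr_lin phil.
  by exists c => // f; apply: (le_trans (phic _));
    rewrite ler_wpM2l // restr_sqnorm_le.
apply: (@bounded_functional_eq R G (fun f => X (rregular g^-1%g (restr H f)) x)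
  ((fun f => ell2_dot f (flip x (X (delta g)))) \o restr H)).
- apply: (bf (fun f => X (rregular g^-1%g f) x)).
  by apply: (@bounded_functional_eval R G (X \o rregular g^-1%g)); apply:
    bounded_comp => //; exact: bounded_rregular.
- by apply: bf; exact: bounded_functional_dot.
move=> y /=; rewrite restr_delta; case: ifPn => [|_]; last first.
  by rewrite dot0l (bounded_op0 (@bounded_rregular R G _)) (bounded_op0 Xb).
rewrite inE => Hy; rewrite dot_conj dot_delta flipE conjcK rregular_delta invgK.
rewrite -(lregular_delta R y g) -[LHS]/((X \o lregular R y) (delta g) x) XL //.
Qed.

Lemma convolvers_lregular H s : H s -> convolvers H (lregular R s).
Proof.
move=> Hs; split; first exact: bounded_lregular.
  by move=> g; apply/funext => f; apply: ell2_ext => x /=; rewrite mulgA.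
move=> x Hx; rewrite lregular_delta /= mulg1; case: eqP => // xs.
by move: Hx; rewrite xs.
Qed.

Lemma convolvers_adjoint H T U : is_subgroup H -> convolvers H T ->
  is_adjoint T U ->
  convolvers H U.
Proof.
move=> HG [Tb TR Ts] TU; split; first exact: bounded_adjoint TU.
  move=> g; apply/funext => f; apply: ell2_ext => x /=;
    rewrite !(adjointE _ _ TU).
  rewrite rregular_adjoint; congr ell2_dot.
  rewrite -[LHS]/((rregular g^-1%g \o T) (delta x)) -TR /=.
  by rewrite rregular_delta invgK.
move=> x Hx; rewrite (adjointE _ _ TU) dot_conj dot_delta convolver_delta // Ts
  ?conjc0 //.
by rewrite mul1g => /(subgroupV HG); rewrite invgK.
Qed.

(** The commutant contains the right translations and the projections onto the
    functions supported on a right coset, and commuting with these forces an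
    operator into the algebra. *)
Lemma convolvers_vna H : is_subgroup H -> is_vna (convolvers H).
Proof.
move=> HG; split; first by move=> T [].
  by move=> T U; exact: convolvers_adjoint.
apply/seteqP; split=> [T [Tb TC]|T HT]; last first.
  by split=> [|X [Xb XT]]; [case: HT|rewrite XT].
split=> // [g|x Hx].
  rewrite TC //; split; first exact: bounded_rregular.
  by move=> U [_ -> _].
have : T \o restr (right_coset H 1%g) = restr (right_coset H 1%g) \o T.
  apply: TC; split; first exact: bounded_restr.
  by move=> U HU; rewrite (convolver_restr _ HG HU).
move=> /(congr1 (fun U : op => U (delta 1%g) x)); rewrite /comp.
rewrite restr_delta mem_set; last exact: right_coset_refl.
by rewrite restrE memNset // /right_coset /= invg1 mulg1.
Qed.

Lemma vna_convolvers H (N : set op) : is_vna N ->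
  (forall s, H s -> N (lregular R s)) -> convolvers H `<=` N.
Proof.
move=> [_ _ NE] HN T HT; rewrite -NE; split; first by case: HT.
move=> X [Xb XN]; rewrite (convolver_commutant (H := H) HT) //.
split=> // _ [s Hs <-]; exact/XN/HN.
Qed.

Theorem group_vnaE H : is_subgroup H -> group_vna R H = convolvers H.
Proof.
move=> HG; apply/seteqP; split.
  apply: smallest_sub; first exact: convolvers_vna.
  by move=> _ [s Hs <-]; exact: convolvers_lregular.
move=> T HT N [NV LN]; apply: vna_convolvers NV _ _ HT.
by move=> s Hs; apply: LN; exists s.
Qed.

End GroupVonNeumannAlgebra.

(** * Conditional expectations *)

Section Fibers.
Variables (R : realType) (G : groupType) (J : choiceType) (q : G -> J).

Definition on_fiber (r : J) (F : G -> R) : G -> R :=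
  fun x => if q x == r then F x else 0.

Lemma on_fiber_ge0 r F : (forall x, 0 <= F x) -> forall x, 0 <= on_fiber r F x.
Proof. by move=> F0 x; rewrite /on_fiber; case: ifP. Qed.

Lemma psum_fiber (F : G -> R) : (forall x, 0 <= F x) ->
  psum F = (\esum_(r in [set: J]) psum (on_fiber r F))%E.
Proof.
move=> F0.
have -> : (\esum_(r in [set: J]) psum (on_fiber r F) =
    \esum_(r in [set: J]) \esum_(x in [set x | q x = r]) (F x)%:E)%E.
  apply: eq_esum => r _; rewrite [RHS]esum_mkcond /psum; apply: eq_esum => x _.
  rewrite /on_fiber; case: eqP => [qx|qx]; first by rewrite mem_set.
  by rewrite memNset.
rewrite esum_esum; last by move=> r x _ _; rewrite lee_fin.
rewrite (reindex_esum [set: G] _ (fun x => (q x, x))) //.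
split=> [x _ //|x y _ _ [] //|[r x] /= [_ <-]].
by exists x.
Qed.

Lemma psum_fiber_le (F H : G -> R) : (forall x, 0 <= F x) ->
  (forall x, 0 <= H x) ->
  (forall r, (psum (on_fiber r F) <= psum (on_fiber r H))%E) ->
    (psum F <= psum H)%E.
Proof.
by move=> F0 H0 FH; rewrite (psum_fiber F0) (psum_fiber H0); apply:
  le_esum => r _.
Qed.

(** The negative parts sum to at most as much as the positive parts on every
    fibre, hence in total. *)
Lemma real_sum_fiber_ge0 (h : G -> R) : abs_summable h ->
  (forall r, 0 <= real_sum (on_fiber r h)) -> 0 <= real_sum h.
Proof.
move=> hs hr; rewrite /real_sum -!/(psum _) subr_ge0.
have p0 x : 0 <= h^\+ x by exact: pos_part_ge0.
have n0 x : 0 <= h^\- x by exact: neg_part_ge0.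
apply: fine_le.
- exact/psum_fin_num/neg_part_summable.
- exact/psum_fin_num/pos_part_summable.
apply: psum_fiber_le => // r.
have fp : (on_fiber r h)^\+ = on_fiber r h^\+.
  by apply/funext => x; rewrite /funrpos /on_fiber; case: ifP => // _;
    rewrite maxxx.
have fn : (on_fiber r h)^\- = on_fiber r h^\-.
  by apply/funext => x; rewrite /funrneg /on_fiber; case: ifP => // _;
    rewrite oppr0 maxxx.
have := hr r; rewrite /real_sum -!/(psum _) fp fn subr_ge0.
have fs (F : G -> R) : (forall x, 0 <= F x) -> (psum F < +oo)%E ->
    psum (on_fiber r F) \is a fin_num.
  move=> F0 Ff; apply: psum_fin_num; first exact: on_fiber_ge0.
  apply: le_lt_trans Ff; apply: psum_le => x.
  by rewrite /on_fiber; case: ifP.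
have fps := fs _ p0 (pos_part_summable hs).
have fns := fs _ n0 (neg_part_summable hs).
by rewrite -lee_fin !fineK.
Qed.

End Fibers.

Section ConditionalExpectation.
Variables (R : realType) (G : groupType).
Local Notation C := R[i].
Local Notation ell2 := (ell2 R G).
Local Notation op := (ell2 -> ell2).
Local Notation delta := (@ell2_delta R G).
Implicit Types (T U S : op) (f : ell2) (H : set G).

Lemma right_coset_eq H x y : is_subgroup H -> right_coset H y x ->
  right_coset H x = right_coset H y.
Proof.
move=> HG yx; have xy := right_coset_sym HG yx.
by apply/seteqP; split=> z zx;
  [apply: (right_coset_mem HG yx)|apply: (right_coset_mem HG xy)].
Qed.

Lemma mem_right_coset H x y : is_subgroup H ->
  (y \in right_coset H x) = (right_coset H y == right_coset H x).
Proof.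
move=> HG; apply/idP/eqP; first by rewrite inE; exact: right_coset_eq.
by rewrite inE => <-; exact: right_coset_refl.
Qed.

(** The compression of [T] to its diagonal blocks: the sum of P T P over the
    projections P onto the functions supported on a right coset of [H]. *)
Definition cond_exp_fun H T f : G -> C :=
  fun x => T (restr (right_coset H x) f) x.

Definition cond_exp H T f : ell2 := insubd 0 (cond_exp_fun H T f).

(** On a coset r the function coincides with T (restr r f), whose square norm is
    controlled by that of f on r; then sum over the cosets. *)
Lemma cond_exp_mass H T f (c : R) : is_subgroup H -> 0 <= c ->
  (forall g : ell2, sqnorm (T g) <= c * sqnorm g) ->
  (psum (fun x => normc (cond_exp_fun H T f x) ^+ 2)%R
   <= psum (fun x => c * normc (f x) ^+ 2)%R)%E.
Proof.
move=> HG c0 Tc; apply: (@psum_fiber_le _ _ _ (right_coset H)).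
- by move=> x; exact: sqr_ge0.
- by move=> x; rewrite mulr_ge0 // sqr_ge0.
move=> r; have [[x0 r0]|nr] := pselect (exists x0, right_coset H x0 = r);
  last first.
  have nE F : on_fiber (right_coset H) r F = (fun=> 0 : R).
    by apply/funext => x; rewrite /on_fiber; case: eqP => // xr; case: nr;
      exists x.
  by rewrite !nE.
apply: (@le_trans _ _ (sqnorm (T (restr r f)))%:E).
  rewrite -sqnormE massE; apply: psum_le => x; rewrite /on_fiber /cond_exp_fun.
  by case: eqP => [->//|_]; rewrite sqr_ge0.
apply: (@le_trans _ _ (c%:E * ell2_mass (restr r f))%E).
  by rewrite sqnormE -EFinM lee_fin.
rewrite massE -psumZ //; last by move=> x; exact: sqr_ge0.
apply: psum_le => x; rewrite /on_fiber restrE; rewrite -r0 mem_right_coset //.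
by case: ifP => // _; rewrite normc0 expr0n mulr0.
Qed.

Lemma cond_expE H T f x : is_subgroup H -> bounded_op T ->
  cond_exp H T f x = T (restr (right_coset H x) f) x.
Proof.
move=> HG /bounded_opP[_ [c c0 Tc]].
rewrite /cond_exp -[LHS]/(val (insubd (0 : ell2) (cond_exp_fun H T f)) x)
  insubdK //.
apply/asboolP; apply: (le_lt_trans (cond_exp_mass f HG c0 Tc)).
rewrite psumZ //; last by move=> y; exact: sqr_ge0.
by rewrite -massE sqnormE -EFinM ltry.
Qed.

Lemma bounded_cond_exp H T : is_subgroup H -> bounded_op T ->
  bounded_op (cond_exp H T).
Proof.
move=> HG Tb; have cE f x := cond_expE f x HG Tb; have Tl := bounded_linear Tb.
apply/bounded_opP; split.
  by move=> a f g; apply: ell2_ext => x; rewrite ell2E !cE restr_lin Tl.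
have /bounded_opP[_ [c c0 Tc]] := Tb; exists c => // f.
rewrite -lee_fin -sqnormE massE EFinM -sqnormE massE -psumZ //; last first.
  by move=> y; exact: sqr_ge0.
apply: le_trans (cond_exp_mass f HG c0 Tc).
by apply: psum_le => x; rewrite cE.
Qed.

(** <E(T) f, f> is the sum over the right cosets r of <T f_r, f_r>, with f_r
    the restriction of f to r. *)
Lemma cond_exp_positive H T : is_subgroup H -> bounded_op T -> positive_op T ->
  positive_op (cond_exp H T).
Proof.
move=> HG Tb Tp f; set q := right_coset H.
pose h x := cond_exp H T f x * (f x)^*%C.
have fib (F : C -> R) r : F 0 = 0 ->
    on_fiber q r (fun x => F (h x)) = (fun=> 0) \/
    on_fiber q r (fun x => F (h x)) =
      (fun x => F (T (restr r f) x * (restr r f x)^*%C)).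
  move=> F0; have [[x0 r0]|nr] := pselect (exists x0, q x0 = r); last first.
    left; apply/funext => x; rewrite /on_fiber; case: eqP => // xr.
    by case: nr; exists x.
  right; apply/funext => x; rewrite /on_fiber /h cond_expE // restrE -/(q x)
    -r0.
  rewrite mem_right_coset // -/(q x) -/(q x0).
  by case: eqP => [->//|_]; rewrite conjc0 mulr0.
have hs : complex_summable h by exact: dot_summable.
(* F is the real part, the imaginary part or its opposite *)
have sgn (F : C -> R) : F 0 = 0 -> (forall z, `|F z| <= normc z) ->
    (forall g, 0 <= real_sum (fun x => F (T g x * (g x)^*%C))) ->
    0 <= real_sum (fun x => F (h x)).
  move=> F0 Fn Fp; apply: (@real_sum_fiber_ge0 _ _ _ q).
    by apply: abs_summable_le hs => x; exact: Fn.
  move=> r; have [->|->] := fib F r F0; last exact: Fp.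
  by rewrite real_sum_ge0 // psum0.
have Tp' g : 0 <= complex.Re (ell2_dot (T g) g) /\
  complex.Im (ell2_dot (T g) g) = 0.
  by have := Tp g; rewrite lecE => /andP[/eqP -> ->].
rewrite /ell2_dot lecE /=; apply/andP; split; last first.
  apply: sgn => //; first exact: Re_le_normc.
  by move=> g; have [] := Tp' g.
rewrite eq_le; apply/andP; split.
  rewrite -oppr_ge0 -real_sumN; apply: (sgn (fun z => - complex.Im z)).
  - by rewrite oppr0.
  - by move=> z; rewrite normrN; exact: Im_le_normc.
  - by move=> g; rewrite real_sumN oppr_ge0; have [_] := Tp' g;
      rewrite /= => ->.
apply: sgn => //; first exact: Im_le_normc.
by move=> g; have [_] := Tp' g; rewrite /= => ->.
Qed.

Lemma cond_exp_convolvers H T : is_subgroup H -> convolvers [set: G] T ->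
  convolvers H (cond_exp H T).
Proof.
move=> HG [Tb TR _]; split; first exact: bounded_cond_exp.
  move=> g; apply/funext => f; rewrite /comp; apply: ell2_ext => x.
  rewrite rregularE !cond_expE //.
  have -> : restr (right_coset H x) (rregular g f) =
    rregular g (restr (right_coset H (x * g)%g) f).
    apply: ell2_ext => y; rewrite rregularE !restrE rregularE.
    by rewrite (_ : (y * g \in right_coset H (x * g))%g =
      (y \in right_coset H x)) //;
      apply/idP/idP; rewrite !inE /right_coset /=
        invgM -mulgA ?(mulgA g) ?mulVKg ?mulKVg ?mulgA ?mulgK.
  by rewrite -[LHS]/((T \o rregular g) _ x) TR.
move=> x Hx; rewrite cond_expE // restr_delta memNset ?(bounded_op0 Tb) //.
by rewrite /right_coset /= mul1g => /(subgroupV HG); rewrite invgK.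
Qed.

Lemma convolvers_mono H K : H `<=` K -> convolvers H `<=` @convolvers R G K.
Proof. by move=> HK T [Tb TR Ts]; split=> // x nK; apply: Ts => /HK. Qed.

Lemma cond_exp_id H T : is_subgroup H -> convolvers H T -> cond_exp H T = T.
Proof.
move=> HG HT; have [Tb _ _] := HT; apply/funext => f; apply: ell2_ext => x.
rewrite cond_expE // -[LHS]/((T \o restr (right_coset H x)) f x)
  (convolver_restr _ HG HT).
by rewrite /comp restrE mem_set //; exact: right_coset_refl.
Qed.

Lemma is_cond_exp_cond_exp H : is_subgroup H ->
  is_cond_exp (convolvers [set: G]) (convolvers H) (cond_exp H).
Proof.
move=> HG; split.
- split=> T HT; first exact: cond_exp_convolvers.
  exact: cond_exp_id.
- move=> a T U [Tb _ _] [Ub _ _]; apply/funext => f; apply: ell2_ext => x.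
  rewrite cond_expE //; last exact: bounded_lin.
  by rewrite -[RHS]/(a * cond_exp H T f x + cond_exp H U f x) !cond_expE.
- move=> S T U HS [Tb _ _] HU; have [[Sb _ _] [Ub _ _]] := (HS, HU).
  apply/funext => f; rewrite /comp; apply: ell2_ext => x.
  rewrite cond_expE //; last by apply: bounded_comp => //; exact: bounded_comp.
  set P := restr (right_coset H x).
  have SP g : S (P g) = P (S g).
    by rewrite -[LHS]/((S \o P) g) (convolver_restr _ HG HS).
  have UP g : U (P g) = P (U g).
    by rewrite -[LHS]/((U \o P) g) (convolver_restr _ HG HU).
  have Px g : P g x = g x.
    by rewrite restrE mem_set //; exact: right_coset_refl.
  rewrite /comp UP -[LHS]Px -[RHS]Px -!SP; congr (S _ x).
  apply: ell2_ext => y; rewrite !restrE; case: ifPn => // yx.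
  rewrite cond_expE //; rewrite inE in yx.
  by rewrite (right_coset_eq HG yx).
- by move=> T [Tb _ _]; exact: cond_exp_positive.
- move=> T [Tb _ _]; rewrite /vtrace !dot_delta cond_expE // restr_delta
    mem_set //.
  exact: right_coset_refl.
Qed.

Lemma cond_exp_comp H K T : is_subgroup H -> is_subgroup K -> bounded_op T ->
  is_subgroup (H `&` K) -> cond_exp H (cond_exp K T) = cond_exp (H `&` K) T.
Proof.
move=> HG KG Tb HKG; apply/funext => f; apply: ell2_ext => x.
rewrite !cond_expE //; last exact: bounded_cond_exp.
rewrite restr_restr; congr (T (restr _ f) x).
by rewrite setIC.
Qed.

Lemma subgroupI H K : is_subgroup H -> is_subgroup K -> is_subgroup (H `&` K).
Proof.
move=> HG KG; split; first by split; exact: subgroup1.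
by move=> x y [Hx Kx] [Hy Ky]; split; [exact: HG.2|exact: KG.2].
Qed.

Lemma commuting_square_convolvers A B K D : is_subgroup B -> is_subgroup K ->
  A = B `&` K -> B `<=` D -> K `<=` D ->
  commuting_square (convolvers [set: G]) (@convolvers R G A) (convolvers B)
    (convolvers K) (convolvers D).
Proof.
move=> BG KG -> BD KD; have BKG := subgroupI BG KG; split.
- by apply: convolvers_mono; exact: subIsetl.
- exact: convolvers_mono.
- by apply: convolvers_mono; exact: subIsetr.
- exact: convolvers_mono.
- exists (cond_exp (B `&` K)), (cond_exp B), (cond_exp K); split; try exact:
    is_cond_exp_cond_exp.
  by move=> T [Tb _ _]; exact: cond_exp_comp.
Qed.

(** * Freeness read off from supports *)

(** With f = U delta_1, the value of T f at g is the convolution sum of the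
    f(y) xi(g y^-1), xi being the symbol of [T]; if all its terms vanish, then
    the functional f' |-> (T f')(g) kills the point masses in the support of f,
    hence f itself. *)
Lemma comp_support T U g : bounded_op T ->
  (forall g, T \o rregular g = rregular g \o T) ->
  T (U (delta 1%g)) g <> 0 ->
  exists y, U (delta 1%g) y <> 0 /\ T (delta 1%g) (g * y^-1)%g <> 0.
Proof.
move=> Tb TR Tg; apply: contrapT => nex; apply: Tg.
set f := U _ in nex *; pose Z := [set y | f y <> 0].
have -> : f = restr Z f.
  apply: ell2_ext => y; rewrite restrE; case: ifPn => // /negP;
    rewrite inE => nZ.
  by apply: contrapT.
have Zb : bounded_op (T \o restr Z).
  by apply: bounded_comp => //; exact: bounded_restr.
have zero : bounded_functional (fun _ : ell2 => 0 : C).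
  split; first by move=> a u v; rewrite scaler0 addr0.
  by exists 0 => // u; rewrite normc0 expr0n mul0r.
apply: (@bounded_functional_eq R G (fun f => (T \o restr Z) f g) (fun=> 0))
  => //.
  exact: bounded_functional_eval.
move=> y; rewrite /comp restr_delta; case: ifPn => [|_];
  last by rewrite (bounded_op0 Tb).
rewrite inE => Zy; rewrite convolver_delta //; apply: contrapT => Ty.
by apply: nex; exists y.
Qed.

Lemma prod_convolvers n (x : nat -> op) :
  (forall k, (k <= n)%N -> convolvers [set: G] (x k)) ->
  convolvers [set: G] (\big[(fun T U => T \o U) / idfun]_(k < n.+1) x k) /\
  forall g,
    (\big[(fun T U => T \o U) / idfun]_(k < n.+1) x k) (delta 1%g) g <> 0 ->
  exists h : nat -> G, (forall k, (k <= n)%N -> x k (delta 1%g) (h k) <> 0) /\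
    g = (\prod_(k < n.+1) h k)%g.
Proof.
elim: n x => [|n IH] x Hx.
  rewrite big_ord_recl big_ord0 (_ : x ord0 \o idfun = x 0%N) //.
  split=> [|g xg]; first exact: Hx.
  exists (fun=> g); split; first by move=> k; rewrite leqn0 => /eqP ->.
  by rewrite big_ord_recl big_ord0 mulg1.
have [[Pb PR _] Psupp] := IH (x \o succn) (fun k kn => Hx k.+1 kn).
have [x0b x0R _] := Hx 0%N (leq0n _).
rewrite big_ord_recl; set P := bigop.body _ _ _ in Pb PR Psupp *.
split.
  split=> [|g|g /(_ I) //]; first exact: bounded_comp.
  by rewrite -compA PR compA x0R.
move=> g /(comp_support (U := P) x0b x0R) [y [Py x0y]].
have [h [hs yE]] := Psupp y Py.
exists (fun k => if k is k'.+1 then h k' else (g * y^-1)%g); split.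
  by case=> [//|k] kn; exact: hs.
by rewrite big_ord_recl /= -yE mulgVK.
Qed.

(** Centred operators have symbols supported off [A], and the symbol of an
    alternating product is supported on alternating products of such
    elements. *)
Lemma free_wrt_convolvers (V : nmodType) (phi : op -> V) (I : eqType)
    (B : I -> set op) (H : I -> set G) (A : set G) :
  (forall i, B i `<=` convolvers (H i)) ->
  (forall T, convolvers [set: G] T ->
     phi T = 0 <-> forall x, A x -> T (delta 1%g) x = 0) ->
  (forall n (i : nat -> I) (h : nat -> G),
     (forall k, (k <= n)%N -> H (i k) (h k) /\ ~ A (h k)) ->
     (forall k, (k < n)%N -> i k != i k.+1) -> ~ A (\prod_(k < n.+1) h k)%g) ->
  free_wrt phi B.
Proof.
move=> BH phiA free n i x Hx Hi.
have Hx' k : (k <= n)%N -> convolvers [set: G] (x k).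
  by move=> /Hx[/BH + _]; exact: convolvers_mono.
have [Pc Psupp] := prod_convolvers Hx'.
apply/phiA => // g Ag; apply: contrapT => /Psupp[h [hs gE]].
have := free n i h; rewrite -gE; apply=> // k kn; have [xB x0] := Hx k kn.
have [xb xR xs] := BH _ _ xB; split.
  by apply: contrapT => /xs; exact: hs.
by move=> Ah; apply: (hs k kn); apply: (iffLR (phiA _ (Hx' k kn)) x0).
Qed.

Lemma cond_exp_eq0 H T : is_subgroup H -> convolvers [set: G] T ->
  cond_exp H T = 0 <-> forall x, H x -> T (delta 1%g) x = 0.
Proof.
move=> HG HT; have [Tb TR _] := HT.
have cE x : H x -> cond_exp H T (delta 1%g) x = T (delta 1%g) x.
  move=> Hx; rewrite cond_expE // restr_delta mem_set //.
  by rewrite /right_coset /= mul1g; exact: (subgroupV HG).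
split=> [E x Hx|T0]; first by rewrite -cE // E.
have [cb cR cs] := cond_exp_convolvers HG HT.
apply: bounded_op_eq => //.
  apply/bounded_opP; split; first by move=> a f g; rewrite scaler0 addr0.
  exists 0 => // f; rewrite mul0r (_ : sqnorm _ = 0) //.
  by apply: complexI; rewrite -dot_self dot0l.
move=> y; apply: ell2_ext => x; rewrite -[RHS]/(0 : C) convolver_delta //.
have [Hxy|] := pselect (H (x * y^-1)%g); last exact: cs.
by rewrite cE // T0.
Qed.

End ConditionalExpectation.

End VonNeumannAlgebras.

(** * Generators and scalars *)

Section StarSubalgebras.
Variables (R : realType) (G : groupType).
Local Notation op := (ell2 R G -> ell2 R G).
Implicit Types (N : set op) (S : set G).

Lemma vna_comp N (T U : op) : is_vna N -> N T -> N U -> N (T \o U).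
Proof.
move=> [Nb _ NE]; rewrite -NE => -[Tb TC] [Ub UC]; split; first exact:
  bounded_comp.
by move=> X NX; rewrite -compA UC // compA TC // compA.
Qed.

Lemma vna_id N : is_vna N -> N (idfun : op).
Proof. by move=> [_ _ <-]; split; [exact: bounded_id|]. Qed.

Lemma vna_lin N (a : R[i]) (T U : op) : is_vna N -> N T -> N U ->
  N (a *: T + U)%R.
Proof.
move=> [Nb _ NE]; rewrite -NE => -[Tb TC] [Ub UC]; split; first exact:
  bounded_lin.
move=> X NX; have Xl := bounded_linear NX.1; apply/funext => f.
have := congr1 (fun T : op => T f) (TC X NX); have :=
  congr1 (fun T : op => T f) (UC X NX).
rewrite /= => EU ET; rewrite -[LHS]/(a *: T (X f) + U (X f))%R ET EU.
by rewrite -[RHS]/(X (a *: T f + U f))%R Xl.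
Qed.

Lemma vna_star N : is_vna N -> is_star_subalgebra N.
Proof.
move=> NV; split.
- by case: NV.
- exact: vna_id.
- by move=> a T U; exact: vna_lin.
- by move=> T U; exact: vna_comp.
- by case: NV.
Qed.

(** The elements s with L_s in a given von Neumann algebra form a subgroup. *)
Lemma gen_vna_group S :
  group_vna R (gen_subgroup S) = gen_vna (lregular R @` S).
Proof.
have SG := gen_subgroup_subgroup S; apply/seteqP; split; last first.
  move=> T HT N [NV LN]; apply: HT; split=> // _ [s Ss <-].
  by apply: LN; exists s => //; exact: gen_subgroup_gen.
rewrite group_vnaE // => T HT N [NV LN]; apply: (vna_convolvers NV _ HT).
apply: gen_subgroup_min => [|s Ss]; last by apply: LN; exists s.
split; first by rewrite /= lregular1; exact: vna_id.
move=> x y Nx Ny; rewrite /= -lregularM; apply: vna_comp => //.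
case: NV => _ NA _; apply: NA Ny _; exact: lregular_adjoint.
Qed.

Lemma gen_star_convolvers S : is_subgroup S ->
  forall X : set op, X `<=` convolvers S ->
    gen_star_subalgebra X `<=` convolvers S.
Proof.
move=> SG X XS; apply: smallest_sub => //; exact/vna_star/convolvers_vna.
Qed.

Lemma subgroup_trivial : is_subgroup [set (1 : G)%g].
Proof. by split=> // x y -> ->; rewrite /= mulgV. Qed.

Lemma scalar_opsE : @scalar_ops R G = convolvers [set 1%g].
Proof.
have sE (a : R[i]) : (a *: (idfun : op) = (a - 1) *:
  (idfun : op) + (idfun : op))%R.
  by rewrite scalerBl scale1r subrK.
apply/seteqP; split=> [_ [a _ <-]|T [Tb TR Ts]].
  have V := @convolvers_vna R G _ subgroup_trivial.
  by rewrite sE; apply: vna_lin => //; exact: vna_id.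
exists (T (ell2_delta R 1%g) 1%g) => //; apply: bounded_op_eq => //.
  by rewrite sE; apply: bounded_lin; exact: bounded_id.
move=> y; apply: ell2_ext => x; rewrite [RHS]convolver_delta //.
rewrite -[LHS]/(T (ell2_delta R 1%g) 1%g * (x == y)%:R)%R.
have [->|xy] := eqVneq x y; first by rewrite mulgV mulr1.
by rewrite (Ts (x * y^-1)%g) ?mulr0 // => /divg1_eq /eqP; rewrite (negbTE xy).
Qed.

Lemma gen_subgroup0 : gen_subgroup (set0 : set G) = [set 1%g].
Proof.
apply/seteqP; split; first by apply: gen_subgroup_min => //; exact:
  subgroup_trivial.
by move=> _ ->; apply: subgroup1; exact: gen_subgroup_subgroup.
Qed.

Lemma subgroupT : is_subgroup [set: G]. Proof. by []. Qed.

End StarSubalgebras.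

(** * Towers *)

Section Towers.
Variables (R : realType) (x : nat -> braid).

Definition tower_group (r : nat) (t : option nat) : set braid :=
  gen_subgroup [set x s | s in index_range r t].

Local Notation op := (ell2 R braid -> ell2 R braid).
Local Notation tower_vna := (tower (fun r t => group_vna R (tower_group r t))).

Lemma tower_group_subgroup r t : is_subgroup (tower_group r t).
Proof. exact: gen_subgroup_subgroup. Qed.

Lemma tower_group_mono r r' t t' : (r' <= r)%N ->
  (forall s, le_ext s t -> le_ext s t') ->
    tower_group r t `<=` tower_group r' t'.
Proof.
by move=> rr tt; apply: gen_subgroup_mono; apply: image_subset; exact:
  index_range_mono.
Qed.

(** Row r starts with the scalars in column r - 1. *)
Definition in_tower (r : nat) (t : option nat) : bool :=
  if t is Some c then (r <= c.+1)%N else true.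

(** On the leftmost entry of a row, where t = r - 1, the index range is empty,
    so that the scalars are the algebra of the trivial group it generates. *)
Lemma towerE r t : in_tower r t ->
  tower_vna r t = convolvers (tower_group r t).
Proof.
rewrite /tower => rt; case: ifP => [_|].
  by rewrite group_vnaE //; exact: tower_group_subgroup.
case: t rt => [c|//] /= rc /negbT; rewrite -ltnNge => cr.
rewrite scalar_opsE -gen_subgroup0; congr (convolvers (gen_subgroup _)).
apply/seteqP; split=> // _ [s] /andP[/= rs sc] _.
by have := leq_trans rs sc; rewrite leqNgt cr.
Qed.

Lemma tower_group_inclusions : tower_inclusions tower_vna.
Proof.
split=> [r c r0 rc|r t r0 rt].
  rewrite !towerE; [|by rewrite /in_tower; lia..].
  by split; apply: convolvers_mono; apply: tower_group_mono => //= s; lia.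
have [rt1 rt2] : in_tower r.+1 t /\ in_tower r t.
  by case: t rt => //= c rc; rewrite /in_tower; split; lia.
rewrite (towerE rt1) (towerE rt2).
by apply: convolvers_mono; exact: tower_group_mono.
Qed.

Lemma tower_group_cells
    (P : set op -> set op -> set op -> set op -> Prop) :
  (forall r c c', (0 < r)%N -> (r <= c)%N ->
    (forall s, (s <= c)%N -> le_ext s c') ->
     P (convolvers (tower_group r.+1 (Some c)))
       (convolvers (tower_group r.+1 c'))
       (convolvers (tower_group r (Some c))) (convolvers (tower_group r c'))) ->
  tower_cells tower_vna P.
Proof.
move=> HP r c c' r0 rc c'E; have [h1 h2] : in_tower r.+1 c' /\ in_tower r c'.
  by case: c'E => -> //=; rewrite /in_tower; split; lia.
rewrite (towerE h1) (towerE h2) !towerE; [|by rewrite /in_tower; lia..].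
by apply: HP => // s sc; case: c'E => -> //=; lia.
Qed.

Lemma tower_commuting_square r c c' : (forall s, (s <= c)%N -> le_ext s c') ->
  tower_group r.+1 c' `&` tower_group r (Some c)
    `<=` tower_group r.+1 (Some c) ->
  commuting_square (convolvers [set: braid])
    (@convolvers R braid (tower_group r.+1 (Some c)))
      (convolvers (tower_group r.+1 c'))
    (convolvers (tower_group r (Some c))) (convolvers (tower_group r c')).
Proof.
move=> cc' cap; apply: commuting_square_convolvers; try exact:
  tower_group_subgroup.
- apply/seteqP; split=> // y Ay; split.
    by move: y Ay; exact: tower_group_mono.
  by move: y Ay; apply: tower_group_mono.
- exact: tower_group_mono.
- exact: tower_group_mono.
Qed.

End Towers.

(** * Haar unitaries *)

Section Haar.
Variables (R : realType) (G : groupType).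

Lemma vtrace_lregular (s : G) : vtrace R (lregular R s) = ((1%g == s)%:R)%R.
Proof. by rewrite /vtrace dot_delta lregular_delta mulg1. Qed.

Lemma iter_lregular (s : G) n : iter n (lregular R s) = lregular R (s ^+ n)%g.
Proof.
elim: n => [|n IH]; first by rewrite expg0 lregular1.
by rewrite expgS -lregularM -IH.
Qed.

Lemma haar_lregular (s : G) : (forall n, s ^+ n.+1 <> 1)%g ->
  haar_unitary (lregular R s).
Proof.
move=> sn; exists (lregular R s^-1%g).
  split; [exact: bounded_lregular|exact: lregular_adjoint| |].
    by rewrite lregularM mulgV lregular1.
  by rewrite lregularM mulVg lregular1.
case=> [[//|n]|n] _; rewrite /unitary_power iter_lregular vtrace_lregular.
  by case: eqP => // /esym /sn.
case: eqP => // /esym; rewrite expVgn => /eqP; rewrite invg_eq1 => /eqP /sn [].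
Qed.

End Haar.

Lemma gamma_sq_infinite i n : (0 < i)%N -> ((gamma i ^+ 2) ^+ n.+1 <> 1)%g.
Proof.
move=> i0 E; suff : nseq n.+1 (i, true) = [::] by [].
apply: free_val_inj => //; last 1 first.
- rewrite [RHS]/free_val big_nil -E /free_val.
  elim: n {E} => [|n IH]; first by rewrite big_seq1 expg1.
  by rewrite [nseq _ _]/= big_cons IH [RHS]expgS.
- by rewrite /reduced /=; elim: n {E} => //= n IH; rewrite IH eqE /= eqxx.
- by rewrite all_nseq /= i0.
Qed.

Lemma gamma_infinite i n : (0 < i)%N -> (gamma i ^+ n.+1 <> 1)%g.
Proof.
move=> i0 E; apply: (@gamma_sq_infinite i n i0).
by rewrite expgnAC E expg1n.
Qed.

(** * The cells of the two towers *)

Section TowerCells.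
Variable R : realType.

Definition gamma_sq (s : nat) : braid := (gamma s ^+ 2)%g.

Lemma half_cell r c c' : (0 < r)%N -> (r <= c)%N ->
  tower_group gamma r.+1 c' `&` tower_group gamma r (Some c)
  `<=` tower_group gamma r.+1 (Some c).
Proof.
move=> r0 rc y [By Cy]; apply: half_cap => //.
by move: y By {Cy}; exact: half_mono.
Qed.

Lemma index_range_pos r t : (0 < r)%N ->
  index_range r t `<=` [set s | (0 < s)%N].
Proof. by move=> r0 s /andP[rs _]; exact: leq_trans rs. Qed.

Lemma index_range_cap r c c' :
  index_range r.+1 c' `&` index_range r (Some c) `<=` index_range r.+1 (Some c).
Proof. by move=> s [/andP[rs _] /andP[_ sc]]; apply/andP. Qed.

Lemma free_cell r c c' : (0 < r)%N ->
  tower_group gamma_sq r.+1 c' `&` tower_group gamma_sq r (Some c)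
  `<=` tower_group gamma_sq r.+1 (Some c).
Proof.
move=> r0 y [By Cy].
have := free_on_cap (index_range_pos (ltn0Sn r)) (index_range_pos r0) By Cy.
by apply: gen_subgroup_mono; apply: image_subset; exact: index_range_cap.
Qed.

Lemma free_cell_amalgamated r c c' : (0 < r)%N ->
  (forall s, (s <= c)%N -> le_ext s c') ->
  free_amalgamated (convolvers [set: braid])
    (@convolvers R braid (tower_group gamma_sq r.+1 (Some c)))
    (convolvers (tower_group gamma_sq r.+1 c'))
      (convolvers (tower_group gamma_sq r (Some c))).
Proof.
move=> r0 cc'; set A := tower_group gamma_sq r.+1 (Some c).
have AG : is_subgroup A := tower_group_subgroup _ _ _.
split.
- by apply: convolvers_mono; exact: tower_group_mono.
- by apply: convolvers_mono; apply: tower_group_mono.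
exists (cond_exp A); first exact: (@is_cond_exp_cond_exp R braid A AG).
apply: (@free_wrt_convolvers R braid _ _ _ _
  (fun b : bool => free_on (if b then index_range r.+1 c' else index_range r
    (Some c))) A).
- by case.
- by move=> T; exact: (@cond_exp_eq0 R braid A T AG).
move=> n i h; apply: (@free_amalgam _
  (fun b : bool => if b then index_range r.+1 c' else index_range r (Some c))
  (index_range r.+1 (Some c))).
- by case; exact: index_range_pos.
- by case; apply: index_range_mono.
- case=> -[] // _; first exact: index_range_cap.
  by rewrite setIC; exact: index_range_cap.
Qed.

Lemma free_gamma_sq :
  free_wrt (vtrace R) (fun i : nat =>
    gen_star_subalgebra
      [set lregular R (gamma i.+1) \o lregular R (gamma i.+1)]).
Proof.
have A1 : free_on set0 = [set 1%g] by rewrite /free_on image_set0 gen_subgroup0.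
apply: (@free_wrt_convolvers R braid _ _ _ _ (fun i => free_on [set i.+1])
  (free_on set0)).
- move=> i; apply: gen_star_convolvers; first exact: gen_subgroup_subgroup.
  move=> _ ->; rewrite lregularM; apply: convolvers_lregular.
  by apply: gen_subgroup_gen; exists i.+1.
- move=> T _; rewrite A1 /vtrace dot_delta; split=> [T1 _ -> //|]; exact.
move=> n i h; apply: (@free_amalgam _ (fun i => [set i.+1]) set0).
- by move=> j s ->.
- by move=> j s [].
- by move=> j k jk s [-> /= []] /eqP; rewrite (negbTE jk).
Qed.

End TowerCells.

(** * The triangular towers *)

Theorem corollary5p12 (R : realType) :
  let LB := group_vna R [set: braid] in
  let Lgamma := fun s : nat => lregular R (gamma s) in
  let Lhalf := fun r t => group_vna R (half_free_subgroup r t) in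
  let Lfree := fun r t => group_vna R (free_subgroup r t) in
  (* the Haar unitaries L_(gamma_i) and the algebras they generate *)
  (forall i : nat, (0 < i)%N -> haar_unitary (Lgamma i)) /\
  (forall (r : nat) (t : option nat), (0 < r)%N -> le_ext r t ->
     Lhalf r t = gen_vna [set Lgamma s | s in index_range r t]) /\
  (* the first tower *)
  tower_inclusions (tower Lhalf) /\
  tower_cells (tower Lhalf) (commuting_square LB) /\
  (* the free system of Haar unitaries L_(gamma_i)^2 *)
  (forall i : nat, (0 < i)%N -> haar_unitary (Lgamma i \o Lgamma i)) /\
  free_wrt (vtrace R)
    (fun i : nat =>
       gen_star_subalgebra [set Lgamma i.+1 \o Lgamma i.+1]) /\
  (* the second tower: generated by the squares, a restriction of the first *)
  (forall (r : nat) (t : option nat), (0 < r)%N -> le_ext r t ->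
     Lfree r t = gen_vna [set Lgamma s \o Lgamma s | s in index_range r t] /\
     Lfree r t `<=` Lhalf r t) /\
  tower_inclusions (tower Lfree) /\
  tower_cells (tower Lfree) (fun A B C D =>
    commuting_square LB A B C D /\ free_amalgamated LB A B C).
Proof.
move=> LB Lgamma Lhalf Lfree.
have LBE : LB = convolvers [set: braid] := group_vnaE R (subgroupT braid).
have LfreeE : Lfree = fun r t => group_vna R (tower_group gamma_sq r t) by [].
split; first by move=> i i0; apply: haar_lregular => n; exact: gamma_infinite.
split.
  move=> r t _ _; rewrite /Lhalf /half_free_subgroup gen_vna_group.
  by rewrite image_comp.
split; first exact: (tower_group_inclusions R gamma).
split.
  apply: (tower_group_cells (R := R) (x := gamma)) => r c c' r0 rc cc'.
  by rewrite LBE; apply: tower_commuting_square => //; exact: half_cell.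
split.
  move=> i i0; rewrite /Lgamma lregularM; apply: haar_lregular => n.
  exact: gamma_sq_infinite.
split; first exact: free_gamma_sq.
split.
  move=> r t r0 rt; split.
    rewrite /Lfree /free_subgroup gen_vna_group image_comp.
    by congr gen_vna; apply: eq_imagel => s _; rewrite /= -lregularM.
  rewrite /Lfree /Lhalf !group_vnaE; [|exact: gen_subgroup_subgroup..].
  apply: convolvers_mono; apply: gen_subgroup_min; first exact:
    gen_subgroup_subgroup.
  move=> _ [s rs <-]; have HG := half_subgroup r t.
  by apply: (subgroupM HG); apply: gen_subgroup_gen; exists s.
rewrite LfreeE; split; first exact: tower_group_inclusions.
apply: tower_group_cells => r c c' r0 rc cc'; rewrite LBE; split.
  by apply: tower_commuting_square => //; exact: free_cell.
exact: free_cell_amalgamated.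
Qed.
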